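(* Let $\Gamma$ be a tropical curve of genus $g \geq 2$, and let $D$ be a divisor on $\Gamma$ of degree $d$ and nonnegative rank $r=\mathbf r(D)$. Then, for every isolated point $p$ of $\operatorname{WL}(D)$, the Weierstrass gap sequence at $p$ with respect to $D$ is \[ \underline{n}_D(p)=(1,2,\ldots,r,D_p(p)+1), \] where $D_p$ is the $p$-reduced divisor linearly equivalent to $D$ and $D_p(p)$ is its coefficient at $p$. In particular, the $D$-Weierstrass weight of $p$ is $\operatorname{wt}_D(p)=D_p(p)-r$. Furthermore, if $\operatorname{WL}(D)$ is finite, then \[ \sum_{p\in \operatorname{WL}(D)} \operatorname{wt}_D(p)= rg-r+d . \]
   Context: A tropical curve (metric graph) $\Gamma$ is a compact connected metric space with the path metric in which every point $p$ has an open neighborhood isometric to a star with $m=\operatorname{val}(p)\ge 1$ branches of some radius $\varepsilon>0$ centered at $p$ (equivalently, it is obtained from a finite connected graph with positive edge lengths). Its genus is $\dim_{\mathbb R}H_1(\Gamma,\mathbb R)$. $T_p\Gamma$ is the set of the $\operatorname{val}(p)$ outgoing tangent directions at $p$. $\operatorname{Div}(\Gamma)$ is the free abelian group on the points of $\Gamma$; a divisor is a finite sum $D=\sum_p D(p)(p)$, $\deg D=\sum_p D(p)$, and $D$ is effective ($D\ge0$) if all $D(p)\ge 0$. A rational function is a continuous piecewise affine function $f:\Gamma\to\mathbb R$ with integer slopes; $\operatorname{sl}_{p,\nu}(f)$ is its outgoing slope at $p$ along $\nu\in T_p\Gamma$, and $\operatorname{div}(f)=\sum_p\bigl(-\sum_{\nu\in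 T_p\Gamma}\operatorname{sl}_{p,\nu}(f)\bigr)(p)$. $D\sim E$ means $D-E=\operatorname{div}(f)$ for some rational function $f$. The (Baker–Norine) rank $\mathbf r(D)$ is the maximum among $-1$ and the integers $k\ge0$ such that for all $p_1,\dots,p_k\in\Gamma$ the divisor $D-(p_1)-\cdots-(p_k)$ is linearly equivalent to an effective divisor. Gap sequences: for $D$ of degree $d$ and rank $r\ge 0$ and $p\in\Gamma$, $\underline n_D(p)=(n_1<\cdots<n_{r+1})$ lists the positive integers $m$ with $\mathbf r(D-m(p))<\mathbf r(D-(m-1)(p))$; there are exactly $r+1$ of them, all $\le d+1$. The weight is $\operatorname{wt}_D(p)=\sum_{i=1}^{r+1}(n_i-i)$. The $D$-Weierstrass locus is $\operatorname{WL}(D)=\{p\in\Gamma: \mathbf r(D-(r+1)(p))\ge0\}=\{p: \underline n_D(p)\ne(1,2,\dots,r+1)\}$. Reduced divisors: for $q\in\Gamma$, a divisor $E$ is $q$-reduced if (i) $E(p)\ge0$ for all $p\ne q$, and (ii) for every nonempty connected closed subset $A\subseteq\Gamma\setminus\{q\}$ there is $p\in\partial A$ with $E(p)<\operatorname{outdeg}_A(p)$, where $\operatorname{outdeg}_A(p)$ is the number of tangent directions at $p$ going out of $A$. Each divisor is linearly equivalent to a unique $q$-reduced divisor. *)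

(* Defs.v *)
From HB Require Import structures.
From mathcomp Require Import all_boot all_order all_algebra.
From mathcomp Require Import all_classical all_reals all_analysis.
From mathcomp Require Import freeg lra.
Set Implicit Arguments.
Unset Strict Implicit.
Unset Printing Implicit Defensive.
Import Order.TTheory GRing.Theory Num.Theory.
Import numFieldNormedType.Exports.
Local Open Scope classical_set_scope.
Local Open Scope ring_scope.

(* Loops and multiple edges are allowed; the orientation of the edges is an
   arbitrary choice of coordinate on each of them.  Since there is at least one
   edge and the graph is connected, every point has valence at least 1. *)
Record tropicalCurve (R : realType) := TropicalCurve {
  vertex : finType;
  edge : finType;
  src : edge -> vertex;
  tgt : edge -> vertex;
  len : edge -> R;
  len_gt0 : forall e, 0 < len e;
  edge_nonempty : (0 < #|edge|)%N;
  vertex_connected : forall u v : vertex,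
    connect [rel x y | [exists e, ((src e == x) && (tgt e == y))
                               || ((src e == y) && (tgt e == x))]] u v }.

Arguments len_gt0 {R t} e.

(* The genus is the dimension of H_1, computed cellularly as the kernel of the
   boundary map  e |-> tgt e - src e  acting on row vectors. *)
Definition boundary_mx (R : realType) (G : tropicalCurve R) :
    'M[R]_(#|edge G|, #|vertex G|) :=
  \matrix_(i, j) ((tgt (enum_val i) == enum_val j)%:R
                - (src (enum_val i) == enum_val j)%:R).

Definition genus (R : realType) (G : tropicalCurve R) : nat :=
  \rank (kermx (boundary_mx G)).

(* A point of the curve is a vertex or a point [(e, t)], with [0 < t < len e],
   in the interior of an edge. *)
Definition curve_point (R : realType) (G : tropicalCurve R) : Type :=
  (vertex G + {x : edge G * R | 0 < x.2 < len x.1})%type.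

HB.instance Definition _ (R : realType) (G : tropicalCurve R) :=
  Choice.copy (curve_point G)
    (vertex G + {x : edge G * R | 0 < x.2 < len x.1})%type.

Section Metric.
Context {R : realType} {G : tropicalCurve R}.
Implicit Types (p q : curve_point G) (e : edge G).

(* The parametrisation [0, len e] -> G of the edge e. *)
Definition pt e (t : R) : curve_point G :=
  if t <= 0 then inl (src e)
  else if (insub (e, t) : option {x : edge G * R | 0 < x.2 < len x.1}) is Some x
  then inr x else inl (tgt e).

(* [walk p q l]: there is a path of length l from p to q, made of finitely many
   steps each of which stays in one edge. *)
Inductive walk : curve_point G -> curve_point G -> R -> Prop :=
| walk_nil p : walk p p 0
| walk_cons e s t q l : s \in `[0, len e] -> t \in `[0, len e] ->
    walk (pt e t) q l -> walk (pt e s) q (`|s - t| + l).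

Definition path_dist p q : R := inf [set l | walk p q l].

Lemma pt0 e : pt e 0 = inl (src e). Proof. by rewrite /pt lexx. Qed.

Lemma pt_len e : pt e (len e) = inl (tgt e).
Proof.
rewrite /pt leNgt len_gt0/=.
by case: insubP => // x /=; rewrite ltxx andbF.
Qed.

Lemma pt_inner e t (tP : 0 < t < len e) : pt e t = inr (exist _ (e, t) tP).
Proof.
have /andP[t0 tl] := tP; rewrite /pt leNgt t0/=.
case: insubP => [y _ yE|/=]; last by rewrite t0 tl.
by congr inr; apply: val_inj.
Qed.

Lemma ptP p : exists e t, t \in `[0, len e] /\ p = pt e t.
Proof.
case: p => [v|[[e t] tP]]; last first.
  exists e, t; rewrite pt_inner; split => //.
  by have /andP[? ?] := tP; rewrite in_itv/= !ltW.
have /card_gt0P[e0 _] := edge_nonempty G.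
have /connectP[[|w s] /= +] := vertex_connected v (src e0).
  move=> _ <-; exists e0, 0; rewrite pt0; split => //.
  by rewrite in_itv/= lexx ltW ?len_gt0.
move=> /andP[/existsP[e /orP[/andP[/eqP <- _]|/andP[_ /eqP <-]]] _ _].
  by exists e, 0; rewrite pt0 in_itv/= lexx ltW ?len_gt0.
by exists e, (len e); rewrite pt_len in_itv/= lexx ltW ?len_gt0.
Qed.

Lemma walk1 e s t : s \in `[0, len e] -> t \in `[0, len e] ->
  walk (pt e s) (pt e t) `|s - t|.
Proof.
by move=> hs ht; rewrite -[`|_|]addr0; apply: walk_cons => //; apply: walk_nil.
Qed.

Lemma walk_trans p q r a b : walk p q a -> walk q r b -> walk p r (a + b).
Proof.
elim=> [?|e s t {}q l hs ht _ ih /ih w]; first by rewrite add0r.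
by rewrite -addrA; apply: walk_cons.
Qed.

Lemma walk_sym p q a : walk p q a -> walk q p a.
Proof.
elim=> [?|e s t {}q l hs ht _ ih]; first exact: walk_nil.
by rewrite addrC; apply: walk_trans ih _; rewrite distrC; apply: walk1.
Qed.

Lemma walk_ge0 p q a : walk p q a -> 0 <= a.
Proof. by elim=> // e s t {}q l _ _ _ ih; rewrite addr_ge0. Qed.

Lemma walk_ex p q : exists a, walk p q a.
Proof.
have src0 e : 0 \in `[0, len e] by rewrite in_itv/= lexx ltW ?len_gt0.
have tgtl e : len e \in `[0, len e] by rewrite in_itv/= lexx ltW ?len_gt0.
have walkv u v : exists a, walk (inl u) (inl v) a.
  have /connectP[s] := vertex_connected u v.
  elim: s u => [|w s ih] u /=; first by move=> _ ->; exists 0; apply: walk_nil.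
  move=> /andP[ew ws] vE; have [a wa] := ih w ws vE.
  suff [b wb] : exists b, walk (inl u) (inl w) b.
    by exists (b + a); apply: walk_trans wa.
  case/existsP: ew => e /orP[] /andP[/eqP <- /eqP <-];
    by rewrite -pt0 -pt_len; eexists; apply: walk1.
have [e [s [hs ->]]] := ptP p; have [e' [t [ht ->]]] := ptP q.
have [a wa] := walkv (src e) (src e').
exists (`|s - 0| + (a + `|0 - t|)); apply: walk_cons => //.
by apply: walk_trans (walk1 _ ht); rewrite ?src0// !pt0.
Qed.

Lemma walk_has_inf p q : has_inf [set l | walk p q l].
Proof.
split; first exact: walk_ex.
by exists 0 => l; apply: walk_ge0.
Qed.

Lemma path_dist_le p q l : walk p q l -> path_dist p q <= l.
Proof. by move=> w; apply: ge_inf => //; case: (walk_has_inf p q). Qed.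

Lemma path_dist_ltP p q a :
  path_dist p q < a <-> exists2 l, walk p q l & l < a.
Proof.
split=> [/(inf_lt (walk_has_inf p q).1)[l]|[l /path_dist_le]]; first by exists l.
exact: le_lt_trans.
Qed.

Lemma path_dist_ge0 p q : 0 <= path_dist p q.
Proof. by apply: lb_le_inf; [apply: walk_ex|move=> l; apply: walk_ge0]. Qed.

Lemma path_distxx p : path_dist p p = 0.
Proof.
by apply/eqP; rewrite eq_le path_dist_ge0 path_dist_le//; apply: walk_nil.
Qed.

Lemma path_dist_sym p q : path_dist p q = path_dist q p.
Proof.
congr inf; apply/seteqP; split => l /=; exact: walk_sym.
Qed.

Lemma path_dist_triangle q p r :
  path_dist p r <= path_dist p q + path_dist q r.
Proof.
apply/ler_addgt0Pr => e e0.
have /path_dist_ltP[a wa ha] : path_dist p q < path_dist p q + e / 2.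
  by rewrite ltrDl divr_gt0.
have /path_dist_ltP[b wb hb] : path_dist q r < path_dist q r + e / 2.
  by rewrite ltrDl divr_gt0.
have := path_dist_le (walk_trans wa wb); lra.
Qed.

Lemma walk_lipschitz (h : curve_point G -> R) :
    (forall e s t, s \in `[0, len e] -> t \in `[0, len e] ->
      h (pt e t) <= h (pt e s) + `|s - t|) ->
  forall p q l, walk p q l -> h q <= h p + l.
Proof.
move=> hL p q l; elim=> [?|e s t {}q {}l hs ht _ ih]; first by rewrite addr0.
have := hL e s t hs ht; lra.
Qed.

Lemma path_dist_positivity p q : path_dist p q = 0 -> p = q.
Proof.
suff [h hL [hp hq]] : exists2 h : curve_point G -> R,
    (forall e s t, s \in `[0, len e] -> t \in `[0, len e] ->
      h (pt e t) <= h (pt e s) + `|s - t|) &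
    h p = 0 /\ forall q, q <> p -> 0 < h q.
  move=> pq; apply: contrapT => /nesym /hq hq0.
  have /path_dist_ltP[l /(walk_lipschitz hL)] : path_dist p q < h q by rewrite pq.
  by rewrite hp; lra.
case: p => [v|[[e0 t0] h0]]; last have /andP[/= t00 t0l] := h0.
  have [m m0 hm] : exists2 m : R, 0 < m & forall e : edge G, m <= len e.
    exists (\big[Num.min/1]_(e : edge G) len e).
      elim/big_ind: _ => // [x y x0 y0|e _]; last exact: len_gt0.
      by rewrite lt_min x0.
    by move=> e; apply: bigmin_le.
  pose phi e t : R := Num.min (if src e == v then t else m)
    (Num.min m (if tgt e == v then len e - t else m)).
  pose h q := match q : curve_point G with
    | inl u => if u == v then 0 else m | inr x => phi (val x).1 (val x).2 end.
  have hE e t : t \in `[0, len e] -> h (pt e t) = phi e t.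
    rewrite in_itv/= => /andP[t_ge0 t_le].
    have l0 := len_gt0 e; have ml := hm e.
    move: t_ge0; rewrite le_eqVlt => /predU1P[<-|t_gt0].
      rewrite pt0 /= /phi subr0; case: eqP => _.
        by rewrite min_l// le_min ltW//=; case: eqP => _; rewrite ltW.
      by case: eqP => _; rewrite !minEle ?ml ?lexx.
    move: t_le; rewrite le_eqVlt => /predU1P[->|t_lt].
      rewrite pt_len /= /phi subrr; case: (tgt e == v).
        by rewrite (min_r (ltW m0)) min_r//; case: eqP => _; rewrite ltW.
      by rewrite minxx; case: eqP => _; rewrite min_r.
    have tP : 0 < t < len e by rewrite t_gt0 t_lt.
    by rewrite pt_inner.
  exists h; last first.
    split=> [|[u uv|[[e t] /= /andP[t0 tl]] _]] /=; rewrite ?eqxx//.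
      by case: eqP => // uE; case: uv; rewrite uE.
    by rewrite /phi !lt_min m0/=; case: eqP => _; case: eqP => _;
      rewrite ?t0 ?m0 ?subr_gt0 ?tl.
  move=> e s t hs ht; rewrite !hE// /phi.
  have st : s - t <= `|s - t| by apply: ler_norm.
  have ts : t - s <= `|s - t| by rewrite distrC; apply: ler_norm.
  have n0 : 0 <= `|s - t| by [].
  rewrite !addr_minl !le_min !ge_min; apply/and3P; split.
  - by case: (src e == v); apply/orP; left; lra.
  - by apply/orP; right; apply/orP; left; lra.
  - by case: (tgt e == v); apply/orP; right; apply/orP; right; lra.
set p : curve_point G := inr _.
have pE : p = pt e0 t0 by rewrite pt_inner.
pose m := Num.min t0 (len e0 - t0).
have m0 : 0 < m by rewrite lt_min t00 subr_gt0.
pose phi e t : R := if e == e0 then Num.min m `|t - t0| else m.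
pose h q := match q : curve_point G with
  | inl u => m | inr x => phi (val x).1 (val x).2 end.
have mt : m <= t0 by rewrite ge_min lexx.
have ml : m <= len e0 - t0 by rewrite ge_min lexx orbT.
have hE e t : t \in `[0, len e] -> h (pt e t) = phi e t.
  rewrite in_itv/= => /andP[t_ge0 t_le].
  move: t_ge0; rewrite le_eqVlt => /predU1P[<-|t_gt0].
    rewrite pt0 /= /phi; case: eqP => // _.
    by rewrite min_l// sub0r normrN ger0_norm// ltW.
  move: t_le; rewrite le_eqVlt => /predU1P[->|t_lt].
    rewrite pt_len /= /phi; case: eqP => // ->.
    by rewrite min_l// ger0_norm// subr_ge0 ltW.
  have tP : 0 < t < len e by rewrite t_gt0 t_lt.
  by rewrite pt_inner.
exists h; last first.
  split=> [|[u _|[[e t] /= tP] np]] /=.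
  - by rewrite /phi eqxx subrr normr0 min_r// ltW.
  - by [].
  - rewrite /phi; case: eqP => // ee; rewrite lt_min m0/= normr_gt0 subr_eq0.
    apply/eqP => tt; apply: np; rewrite pE -ee -tt.
    by rewrite pt_inner.
move=> e s t hs ht; rewrite !hE// /phi; case: eqP => _; last first.
  by rewrite lerDl.
rewrite addr_minl le_min; apply/andP; split.
  by apply: le_trans (_ : m <= _); rewrite ?lerDl// ge_min lexx.
apply: le_trans (_ : `|t - t0| <= _); first by rewrite ge_min lexx orbT.
by rewrite [leRHS]addrC [`|s - t|]distrC; apply: ler_distD.
Qed.

End Metric.

HB.instance Definition _ (R : realType) (G : tropicalCurve R) :=
  @isMetric.Build R (curve_point G) (@path_dist R G) (@path_distxx R G)
    (@path_dist_positivity R G) (@path_dist_sym R G) (@path_dist_triangle R G).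

Section Divisors.
Context {R : realType} {G : tropicalCurve R}.
Implicit Types (p q : curve_point G) (D E : {freeg (curve_point G)}).
Implicit Types (f : curve_point G -> R).

(* The direction [(e, true)] follows e in the sense of its parametrisation,
   [(e, false)] in the opposite sense; a loop gives two directions at its
   vertex. *)
Definition tangent p : {set edge G * bool} :=
  match p with
  | inl v => [set nu | (if nu.2 then src nu.1 else tgt nu.1) == v]
  | inr x => [set nu | nu.1 == (val x).1]
  end.

(* The point at distance s from p in the direction nu, for nu in [tangent p]
   and s >= 0 small. *)
Definition advance p (nu : edge G * bool) (s : R) : curve_point G :=
  let t := match p with
           | inl _ => if nu.2 then 0 else len nu.1
           | inr x => (val x).2
           end in
  pt nu.1 (if nu.2 then t + s else t - s).

Definition rational_function f : Prop :=
  continuous f /\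
  forall e : edge G, exists2 ts : seq R, itv_partition 0 (len e) ts &
    forall i, (i < size ts)%N -> exists (k : int) (c : R),
      forall t, t \in `[nth 0 (0 :: ts) i, nth 0 ts i] ->
        f (pt e t) = k%:~R * t + c.

Definition slope f p (nu : edge G * bool) : R :=
  lim ((f (advance p nu s) - f p) / s @[s --> 0^'+]).

Definition is_div f D : Prop :=
  forall p, (coeff p D)%:~R = - \sum_(nu in tangent p) slope f p nu.

Definition lin_equiv D E : Prop :=
  exists2 f, rational_function f & is_div f (D - E).

Definition effective D : Prop := forall p, 0 <= coeff p D.

Definition rank_set D : set int :=
  [set k | k = -1 \/
    exists2 n : nat, k = n%:Z & forall ps : n.-tuple (curve_point G),
      exists2 E, effective E & lin_equiv (D - \sum_(p <- ps) << p >>) E].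

(* The maximum of [rank_set D], which is bounded above by max (-1) (deg D). *)
Definition rank D : int :=
  xget (-1) [set k | rank_set D k /\ ubound (rank_set D) k].

(* The strictly increasing list of the gaps. *)
Definition gap_sequence D p : seq int :=
  xget [::] [set s | sorted <%R s /\ forall m : int,
    (m \in s) = (0 < m) && (rank (D - << m *g p >>)
                            < rank (D - << m - 1 *g p >>))].

Definition weight D p : int :=
  \sum_(i < size (gap_sequence D p)) ((gap_sequence D p)`_i - i.+1%:Z).

Definition weierstrass_locus D : set (curve_point G) :=
  [set p | 0 <= rank (D - << rank D + 1 *g p >>)].

Definition outdeg (A : set (curve_point G)) p : nat :=
  #|[set nu in tangent p | `[< \forall s \near 0^'+, ~ A (advance p nu s) >]]|.

Definition is_reduced q E : Prop :=
  (forall p, p != q -> 0 <= coeff p E) /\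
  forall A : set (curve_point G), A !=set0 -> connected A -> closed A -> ~ A q ->
    exists2 p, (closure A `\` interior A) p & coeff p E < (outdeg A p)%:Z.

(* The unique q-reduced divisor linearly equivalent to D. *)
Definition reduced_divisor q D : {freeg (curve_point G)} :=
  xget 0 [set E | is_reduced q E /\ lin_equiv D E].

End Divisors.

(* Main.v *)
Require Import Defs.
From mathcomp Require Import all_boot all_order all_algebra.
From mathcomp Require Import all_classical all_reals all_analysis.
From mathcomp Require Import freeg.
From mathcomp Require Import lra ring zify.
Set Implicit Arguments.
Unset Strict Implicit.
Unset Printing Implicit Defensive.
Import Order.TTheory GRing.Theory Num.Theory.
Import numFieldNormedType.Exports.
Local Open Scope classical_set_scope.
Local Open Scope ring_scope.

(** Let [F] be the pointwise infimum of the functions [f - f p], where [f] ranges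
    over the rational functions with [D + div f] effective.  The slopes of all
    these [f] are bounded, so [F] is one of them, and [D + div F] is the
    [p]-reduced divisor: firing a closed set would lower [F].

    If [D - r(p)] had rank at least 1, a chip could be put at any [c] next to [p],
    and straightening the resulting function between [p] and [c] would gather
    [r + 1] chips at a point of [(p, c]]; so [p] would not be isolated in [WL(D)].

    For the total weight, let [s nu t] be the slope at [x = hpt nu t] along [nu] of
    the lowest function based at [x], which is minimal among the slopes at [x].  On
    an open segment free of [WL(D)] and of the support of [D], [s] is constant, and
    the slopes at the two ends, both taken inwards, add up to [-r].  Summing over a
    subdivision of the curve, the number of segments minus the number of points
    brings in the genus. *)

(** * Real induction, and properties holding near 0 on the right *)

Section RealInduction.
Context {R : realType}.

(** Functions are handled through their germs on the right, with integer slope, along an oriented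
    edge; reversing the orientation gives the other side. Compactness of an edge enters through real
    induction.

    For the gaps, the rank of [D - j(p)] falls by at most 1 at each step. If it is 0 at [j = r], the
    first [r] steps all drop, and a single further gap remains, where effectiveness is lost; this
    happens just after [j = D_p(p)].

    The obstacle with the infimum [F] is that it runs over an infinite family. Away from the support
    of [D] each function lies below its tangent lines, and only finitely many integer slopes occur,
    so locally [F] is a minimum of finitely many lines. The slopes are bounded because a steep
    descent remains steep past each vertex or support point and never returns to one.

    The number [-r] arises because outside [WL(D)] the reduced divisor has exactly [r] chips at its
    base point. Where [D] has none, these are minus the sum of the two outgoing slopes. The delicate
    places are the ends of a segment, which may lie in [WL(D)]: there one-sided continuity of the
    minimal slope needs its own argument. *)

Lemma real_induction (a b : R) (P : R -> Prop) :
    P a ->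
    (forall x, a <= x < b -> (forall y, a <= y <= x -> P y) ->
      \forall s \near 0^'+, P (x + s)) ->
    (forall x, a < x <= b -> (forall y, a <= y < x -> P y) -> P x) ->
  forall x, a <= x <= b -> P x.
Proof.
move=> Pa Pr Pl x /andP[ax xb]; apply: contrapT => nPx.
pose S := [set y | a <= y <= b /\ ~ P y].
have Sx : S x by split => //; rewrite ax.
have Slb : lbound S a by move=> y [/andP[]].
have Sinf : has_inf S by split; [exists x|exists a].
set c := inf S.
have ac : a <= c by apply: lb_le_inf; [exists x|].
have cx : c <= x by apply: ge_inf => //; exists a.
have cb : c <= b := le_trans cx xb.
have Pc y : a <= y < c -> P y.
  move=> /andP[ay yc]; apply: contrapT => nPy.
  move: (yc); apply/negP; rewrite -leNgt; apply: ge_inf; first by exists a.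
  by split => //; rewrite ay ltW// (lt_le_trans yc).
have PPc : P c.
  move: ac; rewrite le_eqVlt => /predU1P[<-//|ac].
  by apply: Pl => //; rewrite ac.
have xc : c < x by rewrite lt_neqAle cx andbT; apply/eqP => cx'; apply: nPx; rewrite -cx'.
have /Pr : a <= c < b by rewrite ac (lt_le_trans xc).
case.
  by move=> y /andP[ay]; rewrite le_eqVlt => /predU1P[->//|yc]; apply: Pc; rewrite ay.
move=> d /= d0 Pd.
have [y Sy yd] : exists2 y, S y & y < c + d by apply: inf_adherent.
have cy : c <= y by apply: ge_inf => //; exists a.
case: Sy => _; apply; move: cy; rewrite le_eqVlt => /predU1P[<-//|cy].
rewrite -(subrKC c y); apply: Pd; rewrite ?subr_gt0//.
by rewrite /ball_ /= sub0r normrN gtr0_norm ?subr_gt0// ltrBlDl.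
Qed.

Lemma near0P (P : R -> Prop) :
  (\forall s \near 0^'+, P s) <-> exists2 d : R, 0 < d & forall s : R, 0 < s < d -> P s.
Proof.
split=> [[d /= d0 Pd]|[d d0 Pd]].
  exists d => // s /andP[s0 sd]; apply: Pd => //=.
  by rewrite sub0r normrN gtr0_norm.
exists d => //= s /=; rewrite sub0r normrN => sd s0; apply: Pd.
by rewrite s0/= -[s]gtr0_norm.
Qed.

Lemma near0_ex (P : R -> Prop) (e : R) : 0 < e ->
  (\forall s \near 0^'+, P s) -> exists2 s : R, 0 < s < e & P s.
Proof.
move=> e0 /near0P[d d0 Pd]; exists (Num.min (d / 2) (e / 2)).
  by rewrite lt_min gt_min !divr_gt0//= gtr_pMr// invf_lt1 ?ltr1n// orbT.
by apply: Pd; rewrite lt_min gt_min !divr_gt0//= gtr_pMr// invf_lt1 ?ltr1n.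
Qed.

Lemma near0_lt (e : R) : 0 < e -> \forall s \near 0^'+, 0 < s < e.
Proof. by move=> e0; apply/near0P; exists e. Qed.

(* A property of germs at [0+] that holds near [0+] also holds near each of the
   points close enough to [0] on the right, on both sides. *)
Lemma near0_near (P : R -> Prop) : (\forall s \near 0^'+, P s) ->
  \forall s \near 0^'+, (\forall u \near 0^'+, P (s + u))
    /\ (\forall u \near 0^'+, P (s - u)).
Proof.
move=> /near0P[d d0 Pd]; apply/near0P; exists d => // s /andP[s0 sd]; split.
  apply/near0P; exists (d - s); rewrite ?subr_gt0// => u /andP[u0 ud].
  by apply: Pd; apply/andP; split; lra.
apply/near0P; exists s => // u /andP[u0 us].
by apply: Pd; apply/andP; split; lra.
Qed.

Lemma near0_seq (I : eqType) (l : seq I) (P : I -> R -> Prop) :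
  (forall i, i \in l -> \forall s \near 0^'+, P i s) ->
  \forall s \near 0^'+, forall i, i \in l -> P i s.
Proof.
elim: l => [|x l ih] h; first by apply: nearW.
have h1 := h x (mem_head _ _).
have /ih h2 : forall i, i \in l -> \forall s \near 0^'+, P i s.
  by move=> i il; apply: h; rewrite in_cons il orbT.
near=> s => i; rewrite in_cons => /predU1P[->|il]; first by near: s.
by move: i il; near: s.
Unshelve. all: by end_near. Qed.

End RealInduction.

(** * Germs along oriented edges, integer slopes and the Laplacian *)

Section Germs.
Context {R : realType} {G : tropicalCurve R}.
Implicit Types (p q : curve_point G) (nu : edge G * bool) (f g : curve_point G -> R).
Implicit Types (t s : R) (k : int).

Definition flip nu : edge G * bool := (nu.1, ~~ nu.2).

(* The point at distance [t] from the origin of the oriented edge [nu]. *)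
Definition hpt nu t : curve_point G :=
  pt nu.1 (if nu.2 then t else len nu.1 - t).

(** Meaningful only for [nu] in [tangent p], where it inverts [hpt nu] on [[0, len)]. The far end of
    [nu] is excluded: it is position 0 of [flip nu], which keeps the two ends of a loop apart. *)
Definition hpos p nu : R :=
  match p with
  | inl _ => 0
  | inr x => if nu.2 then (val x).2 else len nu.1 - (val x).2
  end.

Lemma flipK : involutive flip.
Proof. by case=> e b; rewrite /flip /= negbK. Qed.

Lemma flip_neq nu : flip nu != nu.
Proof. by case: nu => e []; rewrite /flip xpair_eqE andbF. Qed.

Lemma hpt_flip nu t : hpt (flip nu) t = hpt nu (len nu.1 - t).
Proof. by case: nu => e []; rewrite /hpt /= ?subKr. Qed.

Lemma hpt0 nu : hpt nu 0 = inl (if nu.2 then src nu.1 else tgt nu.1).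
Proof. by case: nu => e []; rewrite /hpt /= ?subr0 ?pt0 ?pt_len. Qed.

Lemma hpt_len nu : hpt nu (len nu.1) = inl (if nu.2 then tgt nu.1 else src nu.1).
Proof. by case: nu => e []; rewrite /hpt /= ?subrr ?pt0 ?pt_len. Qed.

Lemma hpt_inner nu t : 0 < t < len nu.1 -> exists tP,
  hpt nu t = inr (exist _ (nu.1, if nu.2 then t else len nu.1 - t) tP).
Proof.
move=> tl; have tP : 0 < (if nu.2 then t else len nu.1 - t) < len nu.1.
  by case: nu.2; lra.
by exists tP; rewrite /hpt pt_inner.
Qed.

Lemma hpos_itv p nu : nu \in tangent p -> 0 <= hpos p nu < len nu.1.
Proof.
case: nu => e b; case: p => [v|[[e' t] tP]]; rewrite inE/=.
  by rewrite lexx len_gt0.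
by move=> /eqP ->; move: tP => /= /andP[t0 tl]; case: b; apply/andP; split; lra.
Qed.

Lemma hposK p nu : nu \in tangent p -> hpt nu (hpos p nu) = p.
Proof.
case: nu => e b; case: p => [v|[[e' t] tP]]; rewrite inE/=.
  by move=> /eqP <-; rewrite hpt0.
by move=> /eqP ->; rewrite /hpt; case: b => /=; rewrite ?subKr pt_inner.
Qed.

Lemma advanceE p nu s : nu \in tangent p -> advance p nu s = hpt nu (hpos p nu + s).
Proof.
case: nu => e b; case: p => [v|[[e' t] tP]]; rewrite inE/= /advance/hpt/= => _.
  by case: b; rewrite /= add0r.
by case: b; congr pt; rewrite /=; ring.
Qed.

Lemma tangent_hpt nu t : 0 <= t < len nu.1 -> nu \in tangent (hpt nu t).
Proof.
move=> /andP[]; rewrite le_eqVlt => /predU1P[<- _|t0 tl].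
  by rewrite hpt0 inE.
by have [|tP ->] := @hpt_inner nu t; rewrite ?t0// inE.
Qed.

Lemma hpos_hpt nu t : 0 <= t < len nu.1 -> hpos (hpt nu t) nu = t.
Proof.
move=> /andP[]; rewrite le_eqVlt => /predU1P[<- _|t0 tl]; first by rewrite hpt0.
have [|tP ->] := @hpt_inner nu t; rewrite ?t0//=.
by case: nu.2; rewrite ?subKr.
Qed.

Lemma hpos_flip nu t : 0 < t < len nu.1 -> hpos (hpt nu t) (flip nu) = len nu.1 - t.
Proof.
move=> tl; rewrite -{1}[t](subKr (len nu.1)) -hpt_flip.
by rewrite (@hpos_hpt (flip nu))//=; lra.
Qed.

Lemma tangent_inner nu t : 0 < t < len nu.1 ->
  tangent (hpt nu t) = [set nu; flip nu]%SET.
Proof.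
case: nu => e' b' /hpt_inner[tP ->]; apply/setP => -[e b].
by rewrite !inE !xpair_eqE/= {tP}; case: b; case: b'; rewrite ?andbT ?andbF ?orbF.
Qed.

Lemma tangent_neq0 p : exists nu, nu \in tangent p.
Proof.
have [e [t [+ ->]]] := ptP p; rewrite in_itv/= => /andP[t0].
rewrite le_eqVlt => /predU1P[->|tl].
  exists (e, false); rewrite -[pt _ _]/(hpt (e, true) (len e)).
  by rewrite -[len e]subr0 -hpt_flip tangent_hpt//= lexx len_gt0.
by exists (e, true); rewrite -[pt _ _]/(hpt (e, true) t) tangent_hpt//= t0.
Qed.

Lemma hpt_inj nu t t' : 0 <= t < len nu.1 -> 0 <= t' < len nu.1 ->
  hpt nu t = hpt nu t' -> t = t'.
Proof. by move=> tl t'l tt; rewrite -(hpos_hpt tl) tt hpos_hpt. Qed.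

Lemma dist_hpt nu s t : 0 <= s <= len nu.1 -> 0 <= t <= len nu.1 ->
  path_dist (hpt nu s) (hpt nu t) <= `|s - t|.
Proof.
move=> hs ht; apply: path_dist_le; rewrite /hpt; case: nu.2 => /=.
  by apply: walk1; rewrite in_itv.
have -> : s - t = (len nu.1 - t) - (len nu.1 - s) by ring.
by rewrite distrC; apply: walk1; rewrite in_itv/=; lra.
Qed.

Definition germ f nu t k :=
  \forall s \near 0^'+, f (hpt nu (t + s)) = f (hpt nu t) + k%:~R * s.

Lemma germ_uniq f nu t k k' : germ f nu t k -> germ f nu t k' -> k = k'.
Proof.
move=> gk gk'; have [s /andP[s0 _] [E E']] := near0_ex ltr01 (filterI gk gk').
move: E'; rewrite E => /addrI /(mulIf (lt0r_neq0 s0)).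
exact: intr_inj.
Qed.

Definition sl f nu t : int := xget 0 [set k | germ f nu t k].

Lemma slE f nu t k : germ f nu t k -> sl f nu t = k.
Proof.
move=> gk; rewrite /sl; case: xgetP => [k' _ gk'|/(_ k)//].
exact: germ_uniq gk' gk.
Qed.

(** The local form of being a rational function. Since [nu] runs over both orientations, germs on
    the left are included, and continuity is a consequence. *)
Definition PL f := forall nu t, 0 <= t < len nu.1 -> exists k, germ f nu t k.

Lemma PL_germ f nu t : PL f -> 0 <= t < len nu.1 -> germ f nu t (sl f nu t).
Proof. by move=> fPL /fPL[k gk]; rewrite (slE gk). Qed.

Lemma PL_tangent f p nu : PL f -> nu \in tangent p ->
  \forall s \near 0^'+, f (hpt nu (hpos p nu + s)) = f p + (sl f nu (hpos p nu))%:~R * s.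
Proof. by move=> fPL nup; have := PL_germ fPL (hpos_itv nup); rewrite /germ hposK. Qed.

Lemma slopeE f p nu : PL f -> nu \in tangent p ->
  slope f p nu = (sl f nu (hpos p nu))%:~R.
Proof.
move=> fPL nup; rewrite /slope; apply: lim_near_cst; first exact: norm_hausdorff.
near=> s; rewrite advanceE//.
have -> : f (hpt nu (hpos p nu + s)) = f p + (sl f nu (hpos p nu))%:~R * s.
  by near: s; apply: PL_tangent.
rewrite addrAC subrr add0r mulfK// gt_eqF//; near: s; exact: nbhs_right_gt.
Unshelve. all: by end_near. Qed.

Lemma germ_near f nu t k : germ f nu t k -> \forall s \near 0^'+,
  germ f nu (t + s) k /\ germ f (flip nu) (len nu.1 - (t + s)) (- k).
Proof.
move=> gk; have gn := near0_near gk; near=> s.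
have gs : f (hpt nu (t + s)) = f (hpt nu t) + k%:~R * s by near: s.
have [gr gl] : (\forall u \near 0^'+, f (hpt nu (t + (s + u))) = f (hpt nu t) + k%:~R * (s + u))
  /\ (\forall u \near 0^'+, f (hpt nu (t + (s - u))) = f (hpt nu t) + k%:~R * (s - u)).
  by near: s.
split.
  by apply: filterS gr => u; rewrite gs -[t + s + u]addrA => ->; ring.
apply: filterS gl => u; rewrite !hpt_flip subKr gs.
have -> : len nu.1 - (len nu.1 - (t + s) + u) = t + (s - u) by ring.
by move=> ->; rewrite rmorphN/=; ring.
Unshelve. all: by end_near. Qed.

Lemma sl_near f nu t : PL f -> 0 <= t < len nu.1 -> \forall s \near 0^'+,
  sl f nu (t + s) = sl f nu t /\ sl f (flip nu) (len nu.1 - (t + s)) = - sl f nu t.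
Proof.
move=> fPL /(PL_germ fPL)/germ_near; apply: filterS => s [g1 g2].
by rewrite (slE g1) (slE g2).
Qed.

Lemma germN f nu t k : germ f nu t k -> germ (fun p => - f p) nu t (- k).
Proof. by apply: filterS => s ->; rewrite rmorphN/=; ring. Qed.

Lemma germD f g nu t k l : germ f nu t k -> germ g nu t l ->
  germ (fun p => f p + g p) nu t (k + l).
Proof. by apply: filterS2 => s -> ->; rewrite rmorphD/=; ring. Qed.

Lemma germ_ext f g nu t k : f (hpt nu t) = g (hpt nu t) ->
  (\forall s \near 0^'+, f (hpt nu (t + s)) = g (hpt nu (t + s))) ->
  germ f nu t k -> germ g nu t k.
Proof. by move=> fg; apply: filterS2 => s; rewrite fg => ->. Qed.

Lemma PLN f : PL f -> PL (fun p => - f p).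
Proof. by move=> fPL nu t /fPL[k /germN]; exists (- k). Qed.

Lemma PLD f g : PL f -> PL g -> PL (fun p => f p + g p).
Proof.
move=> fPL gPL nu t tl; have [k gk] := fPL nu t tl; have [l gl] := gPL nu t tl.
by exists (k + l); apply: germD.
Qed.

(* [- lap f] is the divisor of [f]. *)
Definition lap f p : int := \sum_(nu in tangent p) sl f nu (hpos p nu).

Lemma lapN f p : PL f -> lap (fun p => - f p) p = - lap f p.
Proof.
move=> fPL; rewrite /lap -sumrN; apply: eq_bigr => nu nup; apply: slE.
by apply/germN/PL_germ/hpos_itv.
Qed.

Lemma lapD f g p : PL f -> PL g -> lap (fun p => f p + g p) p = lap f p + lap g p.
Proof.
move=> fPL gPL; rewrite /lap -big_split; apply: eq_bigr => nu nup; apply: slE.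
by apply/germD; apply/PL_germ/hpos_itv.
Qed.

Lemma lap_inner f nu t : 0 < t < len nu.1 ->
  lap f (hpt nu t) = sl f nu t + sl f (flip nu) (len nu.1 - t).
Proof.
move=> tl; rewrite /lap tangent_inner// big_setU1/= ?big_set1.
  by rewrite hpos_flip// hpos_hpt//; case/andP: tl => /ltW->.
by rewrite inE eq_sym flip_neq.
Qed.

End Germs.

(** * Piecewise linear functions on an edge: concavity, slope bounds, continuity *)

Section PLTheory.
Context {R : realType} {G : tropicalCurve R}.
Implicit Types (p q : curve_point G) (nu : edge G * bool) (f g : curve_point G -> R).
Implicit Types (t s a b : R) (k : int).

Lemma sl_right f nu t : PL f -> 0 <= t < len nu.1 -> \forall s \near 0^'+,
  [/\ f (hpt nu (t + s)) = f (hpt nu t) + (sl f nu t)%:~R * s,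
      sl f nu (t + s) = sl f nu t &
      sl f (flip nu) (len nu.1 - (t + s)) = - sl f nu t].
Proof.
move=> fPL tl; apply: filterS2 (PL_germ fPL tl) (sl_near fPL tl).
by move=> s -> [-> ->].
Qed.

Lemma sl_left f nu t : PL f -> 0 < t <= len nu.1 -> \forall s \near 0^'+,
  [/\ f (hpt nu (t - s)) = f (hpt nu t) + (sl f (flip nu) (len nu.1 - t))%:~R * s,
      sl f (flip nu) (len nu.1 - (t - s)) = sl f (flip nu) (len nu.1 - t) &
      sl f nu (t - s) = - sl f (flip nu) (len nu.1 - t)].
Proof.
move=> fPL tl; have tl' : 0 <= len nu.1 - t < len (flip nu).1 by rewrite /=; lra.
apply: filterS (sl_right fPL tl') => s; rewrite !hpt_flip flipK subKr/=.
have -> : len nu.1 - (len nu.1 - t + s) = t - s by ring.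
have -> // : len nu.1 - (t - s) = len nu.1 - t + s by ring.
Qed.

(** Real induction with the germs built in. To reach [t] from below, one is handed a single [t - s]
    whose line passes through the value at [t], which is enough for arguments on slopes. *)
Lemma PL_induction f nu a b (P : R -> Prop) : PL f -> 0 <= a -> b <= len nu.1 ->
    P a ->
    (forall t, a <= t < b -> (forall s, a <= s <= t -> P s) ->
      \forall s \near 0^'+, f (hpt nu (t + s)) = f (hpt nu t) + (sl f nu t)%:~R * s ->
        sl f nu (t + s) = sl f nu t -> P (t + s)) ->
    (forall t, a < t <= b -> forall s, 0 < s -> a <= t - s ->
       f (hpt nu t) = f (hpt nu (t - s)) + (sl f nu (t - s))%:~R * s ->
       sl f nu (t - s) = - sl f (flip nu) (len nu.1 - t) ->
       (forall u, a <= u < t -> P u) -> P t) ->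
  forall t, a <= t <= b -> P t.
Proof.
move=> fPL a0 bl Pa Pr Pl; apply: (@real_induction _ a b P) => // t /andP[ta tb] Pt.
  have tl : 0 <= t < len nu.1 by lra.
  have := Pr t; rewrite ta tb => /(_ isT Pt).
  by apply: filterS2 (sl_right fPL tl) => s [E1 E2 _] /(_ E1 E2).
have tl : 0 < t <= len nu.1 by lra.
have [|s /andP[s0 st] [E1 _ E2]] := @near0_ex _ _ (t - a) _ (sl_left fPL tl).
  by rewrite subr_gt0.
apply: (Pl t _ s) => //; [by rewrite ta|lra|].
by rewrite E1 E2 rmorphN/=; ring.
Qed.

Lemma le_slopes f nu a b k : PL f -> 0 <= a -> b <= len nu.1 ->
  (forall t, a <= t < b -> sl f nu t <= k) ->
  forall t, a <= t <= b -> f (hpt nu t) <= f (hpt nu a) + k%:~R * (t - a).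
Proof.
move=> fPL a0 bl slk.
apply: (@PL_induction f nu a b (fun t => f (hpt nu t) <= f (hpt nu a) + k%:~R * (t - a))) => //; first by rewrite subrr; lra.
  move=> t tab Pt; near=> s => -> _.
  have := Pt t; rewrite lexx andbT; case/andP: (tab) => -> _ /(_ isT) H.
  have kR : (sl f nu t)%:~R <= k%:~R :> R by rewrite ler_int slk.
  have s0 : 0 < s by near: s; apply: nbhs_right_gt.
  have := ler_wpM2r (ltW s0) kR; lra.
move=> t tab s s0 ats E _ Pt; rewrite E.
have /Pt H : a <= t - s < t by lra.
have kR : (sl f nu (t - s))%:~R <= k%:~R :> R by rewrite ler_int slk//; lra.
have := ler_wpM2r (ltW s0) kR; lra.
Unshelve. all: by end_near. Qed.

(** At an interior point [lap] is the right slope minus the left slope, so [lap <= 0] is concavity.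
    It is assumed on the open interval only, since the ends may be vertices or points of the
    support. *)
Lemma concave_slopes f nu a b : PL f -> 0 <= a -> b <= len nu.1 ->
  (forall t, a < t < b -> lap f (hpt nu t) <= 0) ->
  forall t, a <= t < b -> sl f nu t <= sl f nu a.
Proof.
move=> fPL a0 bl lap0 t /andP[at_ tb].
pose P t := t < b -> sl f nu t <= sl f nu a.
suff HP : forall t, a <= t <= b -> P t by apply: HP; rewrite ?at_ ?ltW.
move=> {t at_ tb}; apply: (@PL_induction f nu a b P) => //.
  move=> t /andP[ta tb] Pt; near=> s => _ E; rewrite /P E => _.
  by apply: Pt => //; rewrite ta lexx.
move=> t /andP[ta tb'] s s0 ats _ E Pt tb.
have := lap0 t; rewrite ta tb lap_inner => [/(_ isT)|]; last by lra.
have : sl f nu (t - s) <= sl f nu a by apply: Pt; lra.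
rewrite E; lia.
Unshelve. all: by end_near. Qed.

Lemma concave_le f nu a b : PL f -> 0 <= a -> b <= len nu.1 ->
  (forall t, a < t < b -> lap f (hpt nu t) <= 0) ->
  forall t, a <= t <= b -> f (hpt nu t) <= f (hpt nu a) + (sl f nu a)%:~R * (t - a).
Proof. by move=> fPL a0 bl lap0; apply: le_slopes => //; apply: concave_slopes. Qed.

Lemma concave_slopes_flip f nu a b : PL f -> 0 <= a -> b <= len nu.1 ->
  (forall t, a < t < b -> lap f (hpt nu t) <= 0) ->
  forall t, a < t <= b -> - sl f nu a <= sl f (flip nu) (len nu.1 - t).
Proof.
move=> fPL a0 bl lap0 t /andP[ta tb].
have tl : 0 < t <= len nu.1 by lra.
have [|s /andP[s0 st] [_ _ E]] := @near0_ex _ _ (t - a) _ (sl_left fPL tl).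
  by rewrite subr_gt0.
have := @concave_slopes f nu a b fPL a0 bl lap0 (t - s); rewrite E.
by move=> /(_ _)H; rewrite lerNl H//; lra.
Qed.

Lemma PL_slopes_bounded f : PL f ->
  exists K : nat, forall nu t, 0 <= t < len nu.1 -> sl f nu t <= K%:Z.
Proof.
move=> fPL; suff H nu : exists K : nat, forall t, 0 <= t < len nu.1 -> sl f nu t <= K%:Z.
  have [K HK] := choice H; exists (\max_nu K nu)%N => // nu t /HK /le_trans; apply.
  by rewrite lez_nat (leq_bigmax nu).
pose P x := exists K : nat, forall t, 0 <= t < x -> sl f nu t <= K%:Z.
have len0 : 0 <= len nu.1 <= len nu.1 by rewrite lexx ltW ?len_gt0.
apply: (@real_induction _ 0 (len nu.1) P) len0; first by exists 0%N => t /andP[/le_lt_trans h /h]; rewrite ltxx.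
  move=> x /[dup] xl /andP[x0 xl'] /(_ x); rewrite x0 lexx => /(_ isT)[K HK].
  have /near0P[d d0 Hd] := sl_right fPL xl.
  apply/near0P; exists d => // s sd; exists (maxn K `|sl f nu x|%N) => t /andP[t0 ts].
  have := HK t; rewrite t0/=.
  case: (ltgtP t x) => [_ /(_ isT)|xt _|-> _]; [lia| |lia].
  have [|_ + _] := Hd (t - x); first lra.
  by rewrite subrKC; lia.
move=> x /[dup] xl' /andP[x0 xl] HP.
have /near0P[d d0 Hd] := sl_left fPL xl'.
pose e := Num.min (d / 2) x.
have e0 : 0 < e by rewrite lt_min x0 divr_gt0.
have ed : e <= d / 2 by rewrite ge_min lexx.
have ex : e <= x by rewrite ge_min lexx orbT.
have [|K HK] := HP (x - e); first lra.
exists (maxn K `|sl f (flip nu) (len nu.1 - x)|%N) => t /andP[t0 tx].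
case: (ltP t (x - e)) => tx1.
  have := HK t; rewrite t0 tx1 => /(_ isT).
  lia.
have [|_ _] := Hd (x - t); first by lra.
by rewrite subKr; lia.
Qed.

Lemma PL_lipschitz f (K : nat) : PL f ->
    (forall nu t, 0 <= t < len nu.1 -> sl f nu t <= K%:Z) ->
  forall p q l, walk p q l -> `|f q - f p| <= K%:R * l.
Proof.
move=> fPL HK.
have H nu s t : 0 <= s <= len nu.1 -> 0 <= t <= len nu.1 ->
    f (hpt nu t) <= f (hpt nu s) + K%:R * `|s - t|.
  wlog st : nu s t / s <= t => [W hs ht|hs ht].
    have [st|/ltW ts] := leP s t; first exact: W.
    have := W (flip nu) (len nu.1 - s) (len nu.1 - t).
    rewrite !hpt_flip !subKr/= => /(_ _ _ _).
    have -> : len nu.1 - s - (len nu.1 - t) = - (s - t) by ring.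
    by rewrite normrN; apply; lra.
  have := @le_slopes f nu s t K%:Z fPL _ _ _ t _.
  rewrite -pmulrn distrC ger0_norm ?subr_ge0//; apply; try lra.
  by move=> u usl; apply: HK; lra.
move=> p q l; elim=> [x|e s t x {}l hs ht _ ih]; first by rewrite subrr normr0 mulr0.
have Hst : `|f (pt e t) - f (pt e s)| <= K%:R * `|s - t|.
  rewrite !in_itv/= in hs ht.
  have := H (e, true) s t hs ht; have := H (e, true) t s ht hs.
  by rewrite /hpt/= [`|t - s|]distrC ler_norml; lra.
have := ler_distD (f (pt e t)) (f x) (f (pt e s)); lra.
Qed.

Lemma PL_continuous f : PL f -> continuous f.
Proof.
move=> fPL p; have [K HK] := PL_slopes_bounded fPL.
suff H (e : R) : 0 < e -> \forall q \near p, `|f p - f q| < e.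
  exact/(@pseudometric_normed_Zmodule.cvgrPdist_lt R R^o _ (nbhs p) (nbhs_filter p)).
move=> e0; have K1 : 0 < K%:R + 1 :> R by rewrite ltr_wpDl.
apply/nbhs_ballP; exists (e / (K%:R + 1)); first exact: divr_gt0.
move=> q; rewrite ballEmdist => /path_dist_ltP[l w le].
rewrite distrC (le_lt_trans (PL_lipschitz fPL HK w))//.
have l0 := walk_ge0 w.
rewrite ltr_pdivlMr// in le; rewrite (le_lt_trans _ le)// mulrC ler_wpM2l//; lra.
Qed.

End PLTheory.

(** * Rational functions, their divisors and linear systems *)

Section RationalFunctions.
Context {R : realType} {G : tropicalCurve R}.
Implicit Types (p q : curve_point G) (nu : edge G * bool) (f g : curve_point G -> R).
Implicit Types (D E : {freeg (curve_point G)}).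

Definition affine_pieces (h : R -> R) (a : R) (ts : seq R) :=
  forall i, (i < size ts)%N -> exists (k : int) (c : R),
    forall t, t \in `[nth 0 (a :: ts) i, nth 0 ts i] -> h t = k%:~R * t + c.

Lemma affine_pieces_rcons h a (ts : seq R) (x : R) (k : int) (c : R) : affine_pieces h a ts ->
  (forall t : R, last a ts <= t <= x -> h t = k%:~R * t + c) ->
  affine_pieces h a (rcons ts x).
Proof.
move=> hts hx i; rewrite size_rcons ltnS leq_eqVlt => /predU1P[->|its].
  exists k, c => t; rewrite -rcons_cons !nth_rcons ltnn eqxx /= ltnS leqnn.
  by rewrite -last_nth in_itv/=; apply: hx.
have [k' [c' H]] := hts i its; exists k', c' => t.
by rewrite -rcons_cons !nth_rcons its /= ltnS (ltnW its); apply: H.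
Qed.

(** The piece is open on the right, so that the forward germ at [t] stays inside it; the version
    open on the left serves the reversed edge. *)
Lemma path_piece_right (a : R) (ts : seq R) (t : R) : path <%O a ts -> a <= t < last a ts ->
  exists2 i, (i < size ts)%N & nth 0 (a :: ts) i <= t < nth 0 ts i.
Proof.
elim: ts a => [|b ts ih] a /=; first by move=> _ /andP[/le_lt_trans h /h]; rewrite ltxx.
move=> /andP[ab bts] /andP[a_t tl]; have [tb|bt] := ltP t b.
  by exists 0%N => //=; rewrite a_t tb.
have [|i its H] := ih b bts; first by rewrite bt.
by exists i.+1.
Qed.

Lemma path_piece_left (a : R) (ts : seq R) (t : R) : path <%O a ts -> a < t <= last a ts ->
  exists2 i, (i < size ts)%N & nth 0 (a :: ts) i < t <= nth 0 ts i.
Proof.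
elim: ts a => [|b ts ih] a /=; first by move=> _ /andP[/lt_le_trans h /h]; rewrite ltxx.
move=> /andP[ab bts] /andP[a_t tl]; have [tb|bt] := leP t b.
  by exists 0%N => //=; rewrite a_t tb.
have [|i its H] := ih b bts; first by rewrite bt.
by exists i.+1.
Qed.

(** A finite partition of [[0, x]] into affine pieces is prolonged to the right by the germ at [x],
    and reaches a limit point by its left germ; real induction then covers the edge. *)
Lemma PL_rational f : PL f -> rational_function f.
Proof.
move=> fPL; split; first exact: PL_continuous.
move=> e; pose nu := (e, true) : edge G * bool; pose h t := f (pt e t).
pose P (x : R) := exists ts : seq R, [/\ path <%O 0 ts, last 0 ts = x & affine_pieces h 0 ts].
suff [ts [p0 l0 H]] : P (len e) by exists ts => //; split => //; rewrite l0.
have len0 : 0 <= len e <= len e by rewrite lexx ltW ?len_gt0.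
have ext (y x : R) (k : int) : y < x -> P y ->
    (forall t : R, y <= t <= x -> h t = h y + k%:~R * (t - y)) -> P x.
  move=> yx [ts [p0 l0 H]] hk; exists (rcons ts x); split.
  - by rewrite rcons_path p0 l0.
  - by rewrite last_rcons.
  - apply: (@affine_pieces_rcons _ _ _ _ k (h y - k%:~R * y)) => // t.
    by rewrite l0 => /hk ->; ring.
apply: (@real_induction _ 0 (len e) P) len0; first by exists [::]; split.
  move=> x xl HP; have /near0P[d d0 Hd] := @sl_right _ _ f nu x fPL xl.
  apply/near0P; exists d => // s /andP[s0 sd].
  apply: (ext x _ (sl f nu x)); first lra.
    by apply: HP; rewrite lexx andbT; case/andP: xl.
  move=> t /andP[]; rewrite le_eqVlt => /predU1P[<- _|xt ts]; first by ring.
  have [|+ _ _] := Hd (t - x); first lra.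
  by rewrite subrKC.
move=> x xl HP; have /near0P[d d0 Hd] := @sl_left _ _ f nu x fPL xl.
have /andP[x0 _] := xl.
(* Half of [d] puts [y] strictly inside the domain of the left germ at [x], and the minimum with [x]
   keeps it nonnegative. *)
pose y := x - Num.min (d / 2) x.
have e0 : 0 < Num.min (d / 2) x by rewrite lt_min x0 divr_gt0.
have ed : Num.min (d / 2) x <= d / 2 by rewrite ge_min lexx.
have ex : Num.min (d / 2) x <= x by rewrite ge_min lexx orbT.
set k := sl f (flip nu) (len nu.1 - x) in Hd.
have hE (t : R) : x - d < t <= x -> h t = h x + k%:~R * (x - t).
  move=> /andP[tx]; rewrite le_eqVlt => /predU1P[->|tx']; first by ring.
  by have [|+ _ _] := Hd (x - t); [lra|rewrite subKr].
apply: (ext y _ (- k)); [by rewrite /y; lra|apply: HP; rewrite /y; lra|].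
move=> t /andP[yt tx]; rewrite (hE t) ?(hE y); rewrite /y in yt *; lra.
Qed.

Lemma rational_partition f : rational_function f -> exists ts : edge G -> seq R,
  forall e, [/\ path <%O 0 (ts e), last 0 (ts e) = len e &
    affine_pieces (fun t => f (pt e t)) 0 (ts e)].
Proof.
move=> [_ H]; suff /choice[ts Hts] : forall e, exists ts : seq R,
    [/\ path <%O 0 ts, last 0 ts = len e & affine_pieces (fun t => f (pt e t)) 0 ts].
  by exists ts.
by move=> e; have [ts [p0 /eqP l0] Hts] := H e; exists ts.
Qed.

Lemma affine_germ f nu (a b : R) (k : int) (c : R) :
  (forall t, a <= t <= b -> f (hpt nu t) = k%:~R * t + c) ->
  forall t, a <= t < b -> germ f nu t k.
Proof.
move=> H t /andP[ta tb]; apply/near0P; exists (b - t); first lra.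
by move=> s sb; rewrite !H; [ring|lra|lra].
Qed.

Lemma rational_PL f : rational_function f -> PL f.
Proof.
move=> /rational_partition[ts H] [e b] t tl; have [p0 l0 A] := H e.
case: b tl => /= tl.
  have [|i its /andP[t1 t2]] := @path_piece_right 0 (ts e) t p0; first by rewrite l0.
  have [k [c E]] := A i its; exists k.
  apply: (@affine_germ f (e, true) _ _ k c _ t (introT andP (conj t1 t2))) => s sl.
  by apply: E; rewrite in_itv.
have [|i its /andP[t1 t2]] := @path_piece_left 0 (ts e) (len e - t) p0.
  by rewrite l0; lra.
have [k [c E]] := A i its; exists (- k).
apply: (@affine_germ f (e, false) (len e - nth 0 (ts e) i)
  (len e - nth 0 (0 :: ts e) i) (- k) (c + k%:~R * len e)) => [s sl|]; last by lra.
rewrite /hpt /= E; first by rewrite rmorphN/=; ring.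
by rewrite in_itv/=; lra.
Qed.

(** Off the vertices and the breakpoints of a partition, the two slopes at a point belong to one
    affine piece and cancel. *)
Lemma lap_support f : PL f -> exists L : seq (curve_point G),
  forall p, p \notin L -> lap f p = 0.
Proof.
move=> fPL; have [ts H] := rational_partition (PL_rational fPL).
pose L : seq (curve_point G) := [seq inl v | v <- enum (vertex G)] ++
  flatten [seq [seq pt e t | t <- ts e] | e <- enum (edge G)].
exists L => p; rewrite mem_cat negb_or => /andP[pV pE].
case: p pV pE => [v|[[e t] /= tl]]; first by rewrite map_f// mem_enum.
rewrite -pt_inner -[pt e t]/(hpt (e, true) t) => _ pE.
rewrite lap_inner//=; have [p0 l0 A] := H e.
have [|i its /andP[t1 t2]] := @path_piece_right 0 (ts e) t p0; first by rewrite l0; lra.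
have [k [c E]] := A i its.
have E' (s : R) : nth 0 (0 :: ts e) i <= s <= nth 0 (ts e) i ->
  f (hpt (e, true) s) = k%:~R * s + c by move=> sl; apply: E; rewrite in_itv.
have t1' : nth 0 (0 :: ts e) i < t.
  rewrite lt_neqAle t1 andbT; apply/eqP => t1E; move/negP: pE; apply.
  apply/flattenP; exists [seq pt e t | t <- ts e].
    by apply/mapP; exists e; rewrite ?mem_enum.
  apply: map_f; rewrite -t1E; case: i its t1 t2 {A E E'} t1E => [|i] its /=; last first.
    by move=> _ _ _; apply: mem_nth; apply: ltnW.
  by move=> _ _ t0; move: tl; rewrite -t0 ltxx.
rewrite (slE (affine_germ E' (introT andP (conj t1 t2)))).
have -> : flip (e, true) = (e, false) by [].
rewrite (_ : sl f (e, false) _ = - k) ?subrr//; apply: slE.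
apply: (@affine_germ f (e, false) (len e - nth 0 (ts e) i)
  (len e - nth 0 (0 :: ts e) i) (- k) (c + k%:~R * len e)) => [s sl|]; last by lra.
rewrite /hpt /= E; first by rewrite rmorphN/=; ring.
by rewrite in_itv/=; lra.
Qed.

Lemma lap_divisor f : PL f -> exists E, forall p, coeff p E = lap f p.
Proof.
move=> fPL; have [L HL] := lap_support fPL.
exists (\sum_(q <- undup L) << lap f q *g q >>) => p.
rewrite raddf_sum /=; under eq_bigr do rewrite coeffU.
have [pL|pL] := boolP (p \in undup L).
  rewrite (bigD1_seq p)//= ?undup_uniq// eqxx mulr1 big1 ?addr0// => q qp.
  by rewrite (negbTE qp) mulr0.
rewrite big_seq big1 => [|q qL]; first by rewrite HL// -mem_undup.
by case: eqP => [qp|_]; rewrite ?mulr0//; rewrite -qp qL in pL.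
Qed.

(** This says that [D + div f] is effective, as [div f] is [- lap f]: the space usually written
    [R(D)]. *)
Definition linsys D f := PL f /\ forall p, lap f p <= coeff p D.

Lemma is_divE f D : PL f -> is_div f D <-> forall p, coeff p D = - lap f p.
Proof.
move=> fPL; have E p : - \sum_(nu in tangent p) slope f p nu = (- lap f p)%:~R.
  rewrite rmorphN /lap /= rmorph_sum; congr (- _); apply: eq_bigr => nu.
  exact: slopeE.
split=> H p; last by rewrite E H.
by apply: (@intr_inj R); rewrite H E.
Qed.

(** The function of [lin_equiv], with divisor [D - E], is replaced by its opposite, so that
    [E = D + div f]. *)
Lemma lin_equivP D E : lin_equiv D E <->
  exists2 f, PL f & forall p, coeff p E = coeff p D - lap f p.
Proof.
split=> [[f /rational_PL fPL /(is_divE _ fPL) fD]|[f fPL fD]].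
  exists (fun p => - f p) => [|p]; first exact: PLN.
  by rewrite lapN// -fD coeffB; ring.
exists (fun p => - f p); first exact/PL_rational/PLN.
apply/is_divE; first exact: PLN.
by move=> p; rewrite coeffB fD lapN//; ring.
Qed.

Lemma effective_equivP D :
  (exists2 E, effective E & lin_equiv D E) <-> exists f, linsys D f.
Proof.
split=> [[E E0 /lin_equivP[f fPL fE]]|[f [fPL fD]]].
  by exists f; split=> // p; have := E0 p; rewrite fE subr_ge0.
have [L HL] := lap_divisor fPL; exists (D - L).
  by move=> p; rewrite coeffB HL subr_ge0.
by apply/lin_equivP; exists f => // p; rewrite coeffB HL.
Qed.

End RationalFunctions.

(** * The rank, its decrease along multiples of a point, and the gap sequence *)

Section Rank.
Context {R : realType} {G : tropicalCurve R}.
Implicit Types (p q : curve_point G) (ps : seq (curve_point G)).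
Implicit Types (D E : {freeg (curve_point G)}).

Lemma coeff_points p ps : coeff p (\sum_(q <- ps) << q >>) = (count_mem p ps)%:Z.
Proof.
rewrite raddf_sum /=; elim: ps => [|q ps ih]; first by rewrite big_nil.
by rewrite big_cons ih coeffU mul1r /= PoszD; case: eqP.
Qed.

Lemma coeff_subU (k : int) p q D :
  coeff q (D - << k *g p >>) = coeff q D - (if p == q then k else 0).
Proof. by rewrite coeffB coeffU; case: eqP; rewrite ?mulr1 ?mulr0. Qed.

Lemma linsys_le D E f : (forall p, coeff p D <= coeff p E) -> linsys D f -> linsys E f.
Proof. by move=> DE [fPL fD]; split => // p; apply: le_trans (fD p) (DE p). Qed.

Lemma rank_setP D (n : nat) : rank_set D n%:Z <->
  forall ps, size ps = n -> exists f, linsys (D - \sum_(p <- ps) << p >>) f.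
Proof.
split=> [[//|[m [<-]] H ps /eqP sz]|H]; first by apply/effective_equivP; apply: (H (Tuple sz)).
by right; exists n => // ps; apply/effective_equivP/H; rewrite size_tuple.
Qed.

Lemma rank_set_le D (n m : nat) : (n <= m)%N -> rank_set D m%:Z -> rank_set D n%:Z.
Proof.
move=> nm /rank_setP H; apply/rank_setP => ps sz.
have [e0 _] := card_gt0P (edge_nonempty G).
have [|f Hf] := H (ps ++ nseq (m - n) (inl (src e0))).
  by rewrite size_cat size_nseq sz subnKC.
exists f; apply: linsys_le Hf => p; rewrite !coeffB !coeff_points count_cat; lia.
Qed.

Lemma rank_set_subset D E k :
  (forall p, coeff p D <= coeff p E) -> rank_set D k -> rank_set E k.
Proof.
move=> DE [->|[n -> H]]; first by left.
apply/rank_setP => ps /eqP sz; have /effective_equivP[f Hf] := H (Tuple sz).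
by exists f; apply: linsys_le Hf => p; rewrite !coeffB lerD2r.
Qed.

Lemma rank_set0 D : rank_set D 0 <-> exists f, linsys D f.
Proof.
rewrite (_ : 0 = 0%:Z)// rank_setP; split=> [/(_ [::] erefl)[f]|[f Hf] [] // _].
  by rewrite big_nil subr0; exists f.
by exists f; rewrite big_nil subr0.
Qed.

Lemma rankP D (b : int) : ubound (rank_set D) b ->
  rank_set D (rank D) /\ ubound (rank_set D) (rank D).
Proof.
move=> Hb; rewrite /rank; case: xgetP => [k _ //|/= none]; exfalso.
(* The shift by 1 turns [-1], which always belongs to the rank set, into the natural number 0. *)
pose P n := `[< rank_set D (n%:Z - 1) >].
have P0 : exists n, P n by exists 0%N; apply/asboolP; left.
have Pb n : P n -> (n <= absz (b + 1)%R)%N by move=> /asboolP/Hb; lia.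
case: (ex_maxnP P0 Pb) => m /asboolP Pm mmax; apply: (none (m%:Z - 1)); split => //.
move=> k [->|[n -> Hn]]; first by lia.
have : P n.+1 by apply/asboolP; rewrite (_ : n.+1%:Z - 1 = n%:Z); [right; exists n|lia].
by move=> /mmax; lia.
Qed.

(** A nonnegative value excludes the default [-1] of [xget], so the maximum is attained. The bounds
    on the ranks of all [D - m(p)] come from this one. *)
Lemma rank_natP D (r : nat) : rank D = r%:Z ->
  rank_set D r%:Z /\ ubound (rank_set D) r%:Z.
Proof. by rewrite /rank; case: xgetP => [k _ Hk <-//|_]. Qed.

Lemma rank_ge D (b : int) (n : nat) : ubound (rank_set D) b ->
  (n%:Z <= rank D) <-> rank_set D n%:Z.
Proof.
move=> /rankP[H1 H2]; split => [|/H2//].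
case: H1 => [->//|[m mE Hm]]; rewrite mE lez_nat => nm.
by apply: rank_set_le nm _; right; exists m.
Qed.

Lemma rank_geN1 D (b : int) : ubound (rank_set D) b -> -1 <= rank D.
Proof. by move=> /rankP[[->//|[n -> _]]]. Qed.

Section PointMultiples.
Variables (D : {freeg (curve_point G)}) (r : nat) (p : curve_point G).
Hypothesis rankD : rank D = r%:Z.

Let Dm (m : nat) := D - << m%:Z *g p >>.

Lemma ubound_rank_sub m : ubound (rank_set (Dm m)) r%:Z.
Proof.
move=> k Hk; apply: (rank_natP rankD).2; apply: rank_set_subset Hk => q.
by rewrite coeff_subU; case: eqP; lia.
Qed.

Lemma rank_sub_ge0 m : 0 <= rank (Dm m) <-> exists f, linsys (Dm m) f.
Proof. by rewrite -rank_set0; apply: (@rank_ge _ _ 0%N (@ubound_rank_sub m)). Qed.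

Lemma rank_sub_anti m n : (m <= n)%N -> rank (Dm n) <= rank (Dm m).
Proof.
move=> mn; apply: (rankP (@ubound_rank_sub m)).2.
apply: rank_set_subset (rankP (@ubound_rank_sub n)).1 => q.
by rewrite !coeff_subU; case: eqP; lia.
Qed.

(** Among the tuples that test the rank of [D - m(p)] are those beginning with [p]. *)
Lemma rank_subS m : rank (Dm m) <= rank (Dm m.+1) + 1.
Proof.
have := (rankP (@ubound_rank_sub m)).1; case: (rank (Dm m)) => [[|n] H|[|n] _]; last 2 first.
- by have := rank_geN1 (@ubound_rank_sub m.+1); lia.
- by have := rank_geN1 (@ubound_rank_sub m.+1); lia.
- by have := rank_geN1 (@ubound_rank_sub m.+1); lia.
suff /(rank_ge _ (@ubound_rank_sub m.+1)) : rank_set (Dm m.+1) n%:Z by lia.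
move: H => /rank_setP H; apply/rank_setP => ps sz.
have [|f Hf] := H (p :: ps); first by rewrite /= sz.
exists f; apply: linsys_le Hf => q; rewrite !coeffB !coeff_points !coeffU /=.
by case: eqP; lia.
Qed.

Lemma rank_sub_le (j n : nat) : rank (Dm j) <= rank (Dm (j + n)) + n%:Z.
Proof.
elim: n => [|n ih]; first by rewrite addn0 addr0.
by have := rank_subS (j + n); rewrite addnS; lia.
Qed.

Lemma rank_sub0 : rank (Dm 0) = r%:Z.
Proof. by rewrite /Dm freegU0 subr0. Qed.

Lemma weierstrass_locusP :
  weierstrass_locus D p <-> exists f, linsys (Dm r.+1) f.
Proof.
rewrite /weierstrass_locus /= rankD (_ : r%:Z + 1 = r.+1%:Z) ?rank_sub_ge0//; lia.
Qed.

(** The rank goes from [r] at [j = 0] to at most 0 at [j = r] in steps of at most 1, so each of the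
    first [r] steps is a gap. It then stays 0 as long as [j <= m], and drops to [-1] at [m + 1]. *)
Lemma gap_sequenceE (m : int) : r%:Z < m ->
    (forall j : nat, (exists f, linsys (Dm j) f) <-> j%:Z <= m) ->
    ~ rank_set (Dm r) 1 ->
  gap_sequence D p = rcons [seq i%:Z | i <- iota 1 r] (m + 1).
Proof.
move=> rm Hm rk1.
have rkr : rank (Dm r) <= 0.
  rewrite leNgt; apply/negP => h; apply: rk1.
  by apply/(@rank_ge _ _ 1%N (@ubound_rank_sub r)); lia.
have rho1 j : (j <= r)%N -> rank (Dm j) = r%:Z - j%:Z.
  move=> jr; have := rank_sub_le j (r - j); have := rank_sub_le 0 j.
  by rewrite add0n rank_sub0 subnKC//; lia.
have rho2 j : (r <= j)%N -> j%:Z <= m -> rank (Dm j) = 0.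
  by move=> /rank_sub_anti rj /Hm/rank_sub_ge0; lia.
have rho3 j : m < j%:Z -> rank (Dm j) = -1.
  move=> mj; have := rank_geN1 (@ubound_rank_sub j).
  suff : ~ 0 <= rank (Dm j) by lia.
  by move=> /rank_sub_ge0/Hm; lia.
pose s0 := rcons [seq i%:Z | i <- iota 1 r] (m + 1).
pose gaps s := sorted <%R s /\ forall k : int, (k \in s) =
  (0 < k) && (rank (D - << k *g p >>) < rank (D - << k - 1 *g p >>)).
suff Hs0 : gaps s0.
  rewrite /gap_sequence; case: xgetP => [s _ [s_s s_m]|/(_ s0)/(_ Hs0)//].
  by apply: lt_sorted_eq Hs0.1 _ => // k; rewrite s_m Hs0.2.
split.
  rewrite sorted_pairwise; last exact: lt_trans.
  rewrite pairwise_rcons pairwise_map; apply/andP; split.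
    by apply/allP => _ /mapP[i + ->]; rewrite mem_iota; lia.
  rewrite -(@sorted_pairwise _ (fun x y : nat => x%:Z < y%:Z)); last first.
    by move=> x y z; apply: lt_trans.
  by rewrite (@eq_sorted _ _ ltn)// iota_ltn_sorted.
have s0E k : (k \in s0) = (k == m + 1) || (0 < k <= r%:Z).
  rewrite mem_rcons in_cons; congr (_ || _); apply/mapP/idP => [[i + ->]|kr].
    by rewrite mem_iota; lia.
  by exists `|k|%N; rewrite ?mem_iota; lia.
move=> k; rewrite s0E; case: (ltrP 0 k) => k0; last by lia.
case: k k0 => [[//|k]|//] _; rewrite (_ : k.+1%:Z - 1 = k%:Z) -/(Dm _) -/(Dm _); last lia.
have [kr|kr] := leqP k.+1 r; first by rewrite !rho1; lia.
have [km|km] := ltP k%:Z m; first by rewrite !rho2; lia.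
rewrite (rho3 k.+1); last lia.
have [km'|km'] := eqVneq k%:Z m; first by rewrite rho2; lia.
by rewrite rho3; lia.
Qed.

Lemma weightE (m : int) :
  gap_sequence D p = rcons [seq i%:Z | i <- iota 1 r] (m + 1) ->
  weight D p = m - r%:Z.
Proof.
rewrite /weight => ->; rewrite size_rcons size_map size_iota big_ord_recr /=.
rewrite nth_rcons size_map size_iota ltnn eqxx big1 => [|[i /= ir] _].
  by rewrite add0r -addn1 PoszD; ring.
by rewrite nth_rcons size_map size_iota ir (nth_map 0%N) ?size_iota// nth_iota// subrr.
Qed.

End PointMultiples.

End Rank.

(** * A uniform bound on the slopes of a linear system *)

Section SlopeBound.
Context {R : realType} {G : tropicalCurve R}.
Implicit Types (p q : curve_point G) (nu : edge G * bool) (f : curve_point G -> R).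
Implicit Types (D : {freeg (curve_point G)}).

Lemma next_point (L : seq (curve_point G)) nu (t : R) : 0 <= t < len nu.1 ->
  exists b : R, [/\ t < b <= len nu.1, forall s, t < s < b -> hpt nu s \notin L &
    b = len nu.1 \/ hpt nu b \in L].
Proof.
move=> tl; elim: L => [|q L [b [tb bL bE]]].
  by exists (len nu.1); split; [case/andP: tl => _ ->/=|by []|left].
have [/and3P[qt tq qb]|nq] := boolP [&& nu \in tangent q, t < hpos q nu & hpos q nu < b].
  exists (hpos q nu); split; first by lra.
    move=> s /andP[ts sq]; rewrite in_cons negb_or bL ?andbT; last by lra.
    by apply/eqP => sE; move: (sq); rewrite -sE hpos_hpt ?ltxx//; lra.
  by right; rewrite hposK// mem_head.
exists b; split=> // [s sb|]; last by case: bE => [->|bE]; [left|right; rewrite in_cons bE orbT].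
rewrite in_cons negb_or bL// andbT; apply: contra nq => /eqP <-.
have sl : 0 <= s < len nu.1 by lra.
by rewrite tangent_hpt// hpos_hpt.
Qed.

Definition vertex_points : seq (curve_point G) := [seq inl v | v <- enum (vertex G)].

Lemma mem_vertex_points v : inl v \in vertex_points.
Proof. by rewrite map_f// mem_enum. Qed.

Lemma coeff_bound D : exists M : nat, forall p, coeff p D <= M%:Z.
Proof.
exists (\sum_(q <- dom D) `|coeff q D|)%N => p.
have [pD|/coeff_outdom->//] := boolP (p \in dom D).
by rewrite (big_rem p)//=; lia.
Qed.

Lemma linsys_lap0 D f p : linsys D f -> p \notin dom D -> lap f p <= 0.
Proof. by move=> [_ fD] /coeff_outdom <-. Qed.

(** By concavity [f] falls steeply up to the next vertex or support point, where the slope looking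
    back is at least the new [N]. As [lap f <= M] there, some other direction must descend with
    slope at most minus the previous [N]; the recurrence for [N] is this balance over at most all
    half-edges. The points met are distinct because [f] strictly decreases. *)
Lemma steep_descent D (M k : nat) : (forall p, coeff p D <= M%:Z) ->
    let N := iter k (fun n => #|{: edge G * bool}| * n + M + 1)%N 1%N in
    forall f nu (t : R), linsys D f -> 0 <= t < len nu.1 -> sl f nu t <= - N%:Z ->
  exists s : seq (curve_point G), [/\ size s = k, uniq s,
    {subset s <= vertex_points ++ dom D} &
    forall q, q \in s -> f q < f (hpt nu t)].
Proof.
move=> HM; elim: k => [|k ih] /=; first by move=> f nu t _ _ _; exists [::].
move: ih; set N := iter k _ _ => /= ih f nu t fD tl slN.
have [fPL lapf] := fD.
have [b [/andP[tb bl] bL bE]] := next_point (vertex_points ++ dom D) tl.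
have [t0 tl'] := andP tl.
have conc u : t < u < b -> lap f (hpt nu u) <= 0.
  by move=> /bL; rewrite mem_cat negb_or => /andP[_]; apply: linsys_lap0.
have wS : hpt nu b \in vertex_points ++ dom D.
  by case: bE => [->|//]; rewrite mem_cat hpt_len mem_vertex_points.
have fw : f (hpt nu b) < f (hpt nu t).
  have := concave_le fPL t0 bl conc (t := b); rewrite lexx (ltW tb) => /(_ isT).
  have : (sl f nu t)%:~R < 0 :> R by rewrite ltrz0; lia.
  by rewrite -subr_gt0 in tb; rewrite -(pmulr_llt0 _ tb); lra.
have slb : - sl f nu t <= sl f (flip nu) (len nu.1 - b).
  by apply: concave_slopes_flip conc _ _ => //; rewrite tb lexx.
have bl' : 0 <= len nu.1 - b < len (flip nu).1 by rewrite /=; lra.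
have wE : hpt nu b = hpt (flip nu) (len nu.1 - b) by rewrite hpt_flip subKr.
have wt := tangent_hpt bl'; have wpos := hpos_hpt bl'; rewrite -wE in wt wpos.
have [nu' nut slN'] : exists2 nu', nu' \in tangent (hpt nu b) &
    sl f nu' (hpos (hpt nu b) nu') <= - N%:Z.
  apply: contrapT => none.
  have := le_trans (lapf (hpt nu b)) (HM _).
  rewrite /lap (bigD1 (flip nu))//= wpos.
  set T := \sum_(_ | _) _; suff : - (#|{: edge G * bool}| * N)%N%:Z <= T by lia.
  apply: (@le_trans _ _ (\sum_(nu' | (nu' \in tangent (hpt nu b)) && (nu' != flip nu)) - N%:Z)).
    rewrite sumr_const mulNrn lerN2 PoszM -mulr_natl.
    by rewrite ler_wpM2r// ?natz ?lez_nat ?max_card.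
  apply: ler_sum => nu' /andP[nut _]; rewrite leNgt; apply/negP => h.
  by apply: none; exists nu' => //; lia.
have [s [sz us sS fs]] := ih f nu' _ fD (hpos_itv nut) slN'.
rewrite hposK// in fs.
exists (hpt nu b :: s); split => /=; first by rewrite sz.
- by rewrite us andbT; apply/negP => /fs; rewrite ltxx.
- by move=> q; rewrite in_cons => /predU1P[->|/sS].
- by move=> q; rewrite in_cons => /predU1P[->//|/fs /lt_trans]; apply.
Qed.

Lemma linsys_slopes_bounded D : exists K : nat, forall f nu (t : R),
  linsys D f -> 0 <= t < len nu.1 -> sl f nu t <= K%:Z.
Proof.
have [M HM] := coeff_bound D; set S := vertex_points ++ dom D.
(* One point more than [S] contains, so that no such descent exists. *)
have := @steep_descent D M (size S).+1 HM; set N := iter _ _ _ => /= H.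
exists N => f nu t fD tl.
have lower nu' u : 0 <= u < len nu'.1 -> - N%:Z < sl f nu' u.
  move=> ul; rewrite ltNge; apply/negP => /(H _ _ _ fD ul)[s [sz us sS _]].
  by have := uniq_leq_size us sS; rewrite sz ltnn.
(* A lower bound in the reversed direction just beyond [t] is an upper bound at [t]. *)
have [|s /andP[s0 st] [_ _ E]] := @near0_ex _ _ (len nu.1 - t) _ (sl_right fD.1 tl); first lra.
have := lower (flip nu) (len nu.1 - (t + s)); rewrite E/= => h.
have : - N%:Z < - sl f nu t by apply: h; lra.
lia.
Qed.

End SlopeBound.

(** * The lowest function of a linear system based at a point *)

Section LowestFunction.
Context {R : realType} {G : tropicalCurve R}.
Implicit Types (p q : curve_point G) (nu : edge G * bool) (f : curve_point G -> R).
Implicit Types (D : {freeg (curve_point G)}).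

Lemma seq_argmin (T : eqType) (d : Order.disp_t) (S : orderType d) (h : T -> S)
    (l : seq T) (x : T) : x \in l ->
  exists2 m, m \in l & forall y, y \in l -> (h m <= h y)%O.
Proof.
elim: l x => [//|a [|b l] ih] x _.
  by exists a; rewrite ?mem_head// => y; rewrite inE => /eqP->.
have [m ml Hm] := ih b (mem_head _ _).
have [am|ma] := leP (h a) (h m).
  by exists a; rewrite ?mem_head// => y; rewrite in_cons => /predU1P[->//|/Hm]; apply: le_trans.
exists m; first by rewrite in_cons ml orbT.
by move=> y; rewrite in_cons => /predU1P[->|/Hm//]; rewrite ltW.
Qed.

Lemma slopes_lower f (K : nat) : PL f ->
    (forall nu t, 0 <= t < len nu.1 -> sl f nu t <= K%:Z) ->
  forall nu t, 0 <= t < len nu.1 -> - K%:Z <= sl f nu t.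
Proof.
move=> fPL HK nu t tl.
have [|s /andP[s0 st] [_ _ E]] := @near0_ex _ _ (len nu.1 - t) _ (sl_right fPL tl); first lra.
have := HK (flip nu) (len nu.1 - (t + s)); rewrite E/= => h.
have : - sl f nu t <= K%:Z by apply: h; lra.
lia.
Qed.

Lemma min_affine_germ (h : R -> R) (ks : seq int) (c : int -> R) (b : R) : 0 < b ->
    (forall s k, 0 <= s < b -> k \in ks -> h s <= c k + k%:~R * s) ->
    (forall s, 0 <= s < b -> exists2 k, k \in ks & h s = c k + k%:~R * s) ->
  exists k : int, \forall s \near 0^'+, h s = h 0 + k%:~R * s.
Proof.
move=> b0 hle hE.
have b00 : (0 : R) <= 0 < b by rewrite lexx b0.
have [k1 k1s k1E] := hE 0 b00; rewrite mulr0 addr0 in k1E.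
have k1s' : k1 \in [seq k <- ks | c k == h 0] by rewrite mem_filter k1s k1E eqxx.
(* Among the lines that attain [h 0] at 0, the one of least slope wins on the right. *)
have [k0 + Hk0] := seq_argmin id k1s'.
rewrite mem_filter => /andP[/eqP k0E k0s]; exists k0.
have far : \forall s \near 0^'+, forall k, k \in ks -> h 0 + k0%:~R * s <= c k + k%:~R * s.
  apply: near0_seq => k ks'.
  have := hle 0 k b00 ks'; rewrite mulr0 addr0 le_eqVlt => /predU1P[ckE|ck].
    have /Hk0 kk : k \in [seq k <- ks | c k == h 0] by rewrite mem_filter ks' -ckE eqxx.
    apply/near0P; exists 1 => // s /andP[s0 _]; rewrite -ckE lerD2l.
    by apply: ler_wpM2r; rewrite ?ler_int// ltW.
  have [m m0 km] : exists2 m : R, 0 <= m & k0%:~R - k%:~R <= m.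
    by exists `|k0%:~R - k%:~R|; rewrite ?ler_norm.
  (* A line starting strictly above [h 0] stays above as long as [s * (k0 - k) <= c k - h 0]; the
     added 1 keeps the denominator positive. *)
  apply/near0P; exists ((c k - h 0) / (1 + m)).
    by rewrite divr_gt0 ?subr_gt0// ltr_wpDr.
  move=> s /andP[s0]; rewrite ltr_pdivlMr; last lra.
  have := ler_wpM2l (ltW s0) km; lra.
near=> s; have sb : 0 <= s < b.
  suff: 0 < s < b by case/andP => /ltW -> ->.
  by near: s; apply: near0_lt.
apply/eqP; rewrite eq_le -{1}k0E hle//=.
have [k ks' ->] := hE s sb.
by move: k ks'; near: s.
Unshelve. all: by end_near. Qed.

(* [D + div (lowest D p)] will be the [p]-reduced divisor equivalent to [D]. *)
Definition lowest D p (q : curve_point G) : R :=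
  inf [set y | exists2 f, linsys D f & y = f q - f p].

Section Lowest.
Variables (D : {freeg (curve_point G)}) (p : curve_point G).
Hypothesis linsys0 : exists f, linsys D f.

Lemma lowest_has_inf q : has_inf [set y | exists2 f, linsys D f & y = f q - f p].
Proof.
have [f0 f0D] := linsys0; split; first by exists (f0 q - f0 p); exists f0.
have [K HK] := linsys_slopes_bounded D; have [l w] := walk_ex p q.
exists (- (K%:R * l)) => _ [f fD ->].
have := PL_lipschitz fD.1 (fun nu t => HK f nu t fD) w.
by rewrite ler_norml => /andP[].
Qed.

Lemma lowest_le f q : linsys D f -> lowest D p q <= f q - f p.
Proof. by move=> fD; apply: ge_inf; [case: (lowest_has_inf q)|exists f]. Qed.

Lemma lowest_glb (c : R) q : (forall f, linsys D f -> c <= f q - f p) ->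
  c <= lowest D p q.
Proof.
by move=> Hc; apply: lb_le_inf; [case: (lowest_has_inf q)|move=> _ [f /Hc fD ->]].
Qed.

Lemma lowest_base : lowest D p p = 0.
Proof.
apply/eqP; rewrite eq_le; apply/andP; split.
  by have [f /lowest_le] := linsys0; move=> /(_ p); rewrite subrr.
by apply: lowest_glb => f _; rewrite subrr.
Qed.

Lemma linsys_concave f nu (t b : R) : linsys D f -> 0 <= t -> b <= len nu.1 ->
  (forall s, t < s < b -> hpt nu s \notin dom D) ->
  forall u s, t <= u < b -> t <= s < b ->
    f (hpt nu s) <= f (hpt nu u) + (sl f nu u)%:~R * (s - u).
Proof.
move=> fD t0 bl Db u s /andP[tu ub] /andP[ts sb].
have lap0 v : t < v < b -> lap f (hpt nu v) <= 0 by move=> /Db; apply: linsys_lap0.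
have [us|su] := leP u s.
  apply: (@concave_le _ _ f nu u b fD.1) => //; [lra| |lra].
  by move=> v ?; apply: lap0; lra.
have ul : 0 < u < len nu.1 by lra.
have slD : sl f (flip nu) (len nu.1 - u) <= - sl f nu u.
  have : lap f (hpt nu u) <= 0 by apply: lap0; lra.
  by rewrite lap_inner//; lia.
have := @concave_le _ _ f (flip nu) (len nu.1 - u) (len nu.1 - t) fD.1.
rewrite /= => /(_ _ _ _ (len nu.1 - s) _); rewrite !hpt_flip !subKr => H.
have slDR : (sl f (flip nu) (len nu.1 - u))%:~R <= - (sl f nu u)%:~R :> R.
  by rewrite -rmorphN ler_int.
have su0 : 0 <= u - s by lra.
apply: le_trans (H _ _ _ _) _; [lra|lra| |lra|].
  by move=> v vl; rewrite -[v](subKr (len nu.1)) -hpt_flip flipK lap0//; lra.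
have := ler_wpM2r su0 slDR; lra.
Qed.

(** On [[t, b)], free of the support after [t], every function of the system lies below each of its
    tangent lines. [C k] collects the heights at [t] of the tangent lines of slope [k], normalised
    at [p], and [c k] is their infimum. As the slopes are bounded integers, [lowest D p] is there
    the minimum of finitely many lines. *)
Lemma lowest_PL : PL (lowest D p).
Proof.
move=> nu t tl; have [K HK] := linsys_slopes_bounded D.
have [b [/andP[tb bl] Db _]] := next_point (dom D) tl.
have /andP[t0 _] := tl.
pose C k := [set y | exists f u, [/\ linsys D f, t <= u < b, sl f nu u = k &
  y = f (hpt nu u) - f p - k%:~R * (u - t)]].
pose c k := inf (C k).
have Cle k y s : C k y -> t <= s < b -> lowest D p (hpt nu s) <= y + k%:~R * (s - t).
  move=> [f [u [fD utb <- ->]]] st.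
  have := linsys_concave fD t0 bl Db utb st; have := lowest_le (hpt nu s) fD; lra.
pose ks := [seq k <- [seq i%:Z - K%:Z | i <- iota 0 (K + K).+1] | `[< C k !=set0 >]].
have Cinf k : k \in ks -> has_inf (C k).
  rewrite mem_filter => /andP[/asboolP C0 _]; split => //.
  exists (lowest D p (hpt nu t)) => y /Cle => /(_ t); rewrite subrr mulr0 addr0.
  by apply; rewrite lexx.
have kse f s : linsys D f -> t <= s < b -> sl f nu s \in ks.
  move=> fD st; rewrite mem_filter; apply/andP; split.
    by apply/asboolP; eexists; exists f, s; split.
  have sl' : 0 <= s < len nu.1 by lra.
  have := slopes_lower fD.1 (fun nu t => HK f nu t fD) sl'.
  have := HK f nu s fD sl'; set x := sl f nu s => xK Kx.
  apply/mapP; exists (absz (x + K%:Z)%R); last by lia.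
  by rewrite mem_iota; lia.
have [|||k Hk] := @min_affine_germ (fun s => lowest D p (hpt nu (t + s))) ks c (b - t);
  last by exists k; apply: filterS Hk => s; rewrite addr0.
- lra.
- move=> s k sb kks; rewrite -lerBlDr; apply: lb_le_inf; first by case: (Cinf k kks).
  by move=> y /Cle => /(_ (t + s)); rewrite lerBlDr [t + s]addrC addrK; apply; lra.
- move=> s sb; have [f0 f0D] := linsys0.
  have st : t <= t + s < b by lra.
  have [k kks Hk] := seq_argmin (fun k => c k + k%:~R * s) (kse f0 _ f0D st).
  exists k => //; apply/eqP; rewrite eq_le; apply/andP; split.
    rewrite -lerBlDr; apply: lb_le_inf; first by case: (Cinf k kks).
    by move=> y /Cle => /(_ (t + s) st); rewrite lerBlDr [t + s]addrC addrK.
  apply: lowest_glb => f fD; apply: le_trans (Hk _ (kse f _ fD st)) _.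
  rewrite -lerBrDr; apply: ge_inf; first by case: (Cinf _ (kse f _ fD st)).
  by exists f, (t + s); split => //; rewrite [t + s]addrC addrK.
Qed.

(** If [lap] of the infimum exceeded [D] at [x], every [f] of the system would have at [x] some
    slope smaller by at least 1. Going a distance [d] in that direction, with [d] independent of
    [f], shows that [f x - f p] exceeds the infimum at [x] by at least [d], which is absurd. *)
Lemma lowest_linsys : linsys D (lowest D p).
Proof.
split=> [|x]; first exact: lowest_PL.
rewrite leNgt; apply/negP => lapx.
have [d d0 Hd] : exists2 d : R, 0 < d & forall nu, nu \in tangent x ->
    [/\ hpos x nu + d < len nu.1,
      lowest D p (hpt nu (hpos x nu + d)) =
        lowest D p x + (sl (lowest D p) nu (hpos x nu))%:~R * d &
      forall u, hpos x nu < u < hpos x nu + d -> hpt nu u \notin dom D].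
  have : \forall s \near 0^'+, forall nu, nu \in tangent x ->
    [/\ hpos x nu + s < len nu.1, 
      lowest D p (hpt nu (hpos x nu + s)) =
        lowest D p x + (sl (lowest D p) nu (hpos x nu))%:~R * s &
      forall u, hpos x nu < u < hpos x nu + s -> hpt nu u \notin dom D].
    apply: filter_forall => nu; have [nut|] := boolP (nu \in tangent x); last by move=> ?; apply: nearW.
    have [b [/andP[tb bl] Db _]] := next_point (dom D) (hpos_itv nut).
    have sb0 : 0 < b - hpos x nu by rewrite subr_gt0.
    apply: filterS2 (PL_tangent lowest_PL nut) (near0_lt sb0) => s E /andP[s0 sb] _.
    by split=> //; [lra|move=> u ?; apply: Db; lra].
  by move=> /(near0_ex ltr01)[d /andP[d0 _] Hd]; exists d.
suff : lowest D p x + d <= lowest D p x by lra.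
apply: lowest_glb => f fD.
have [nu nut slf] : exists2 nu, nu \in tangent x &
    sl f nu (hpos x nu) <= sl (lowest D p) nu (hpos x nu) - 1.
  apply: contrapT => none; have := fD.2 x; rewrite leNgt => /negP; apply.
  apply: lt_le_trans lapx _; apply: ler_sum => nu nut; rewrite leNgt; apply/negP => h.
  by apply: none; exists nu => //; lia.
have [dl E Db] := Hd nu nut; have /andP[t0 tl] := hpos_itv nut.
have := lowest_le (hpt nu (hpos x nu + d)) fD; rewrite E.
have := @concave_le _ _ f nu _ _ fD.1 t0 (ltW dl).
move=> /(_ (fun u ul => linsys_lap0 fD (Db u ul)) (hpos x nu + d)).
rewrite hposK// [hpos x nu + d - _]addrAC subrr add0r lexx andbT.
have -> : hpos x nu <= hpos x nu + d by lra.
move=> /(_ isT).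
have slfR : (sl f nu (hpos x nu))%:~R <= (sl (lowest D p) nu (hpos x nu))%:~R - 1 :> R.
  by rewrite -(rmorphB _ _ 1) ler_int.
have := ler_wpM2r (ltW d0) slfR; lra.
Qed.

End Lowest.

End LowestFunction.

(** * Firing a closed set, and reducedness of the divisor of the lowest function *)

Section Firing.
Context {R : realType} {G : tropicalCurve R}.
Implicit Types (p q x : curve_point G) (nu : edge G * bool) (f g : curve_point G -> R).
Implicit Types (D E : {freeg (curve_point G)}) (A : set (curve_point G)).

Lemma sl_le f g nu (t : R) : PL f -> PL g -> 0 <= t < len nu.1 ->
  (\forall s \near 0^'+, f (hpt nu (t + s)) - f (hpt nu t) <= g (hpt nu (t + s)) - g (hpt nu t)) ->
  sl f nu t <= sl g nu t.
Proof.
move=> fPL gPL tl fg.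
have [s /andP[s0 _] [+ [Ef Eg]]] := near0_ex ltr01
  (filterI fg (filterI (PL_germ fPL tl) (PL_germ gPL tl))).
by rewrite Ef Eg ![_ + _ - f _]addrAC ![_ + _ - g _]addrAC !subrr !add0r ler_pM2r// ler_int.
Qed.

Lemma sl_cst_le0 g nu (t : R) : PL g -> 0 <= t < len nu.1 ->
  (\forall s \near 0^'+, g (hpt nu (t + s)) <= g (hpt nu t)) -> sl g nu t <= 0.
Proof.
move=> gPL tl gt; have [s /andP[s0 _] [+ E]] := near0_ex ltr01 (filterI gt (PL_germ gPL tl)).
by rewrite E gerDl pmulr_lle0// -(ler_int R).
Qed.

Lemma sl_ge0 g nu (t : R) : PL g -> 0 <= t < len nu.1 ->
  (\forall s \near 0^'+, g (hpt nu t) <= g (hpt nu (t + s))) -> 0 <= sl g nu t.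
Proof.
move=> gPL tl gt; have [s /andP[s0 _] [+ E]] := near0_ex ltr01 (filterI gt (PL_germ gPL tl)).
by rewrite E lerDl pmulr_lge0// -(ler_int R).
Qed.

Lemma near_hpt nu (t : R) (P : curve_point G -> Prop) : 0 <= t <= len nu.1 ->
  nbhs (hpt nu t) P ->
  exists2 e : R, 0 < e & forall s, 0 <= s <= len nu.1 -> `|t - s| < e -> P (hpt nu s).
Proof.
move=> tl /nbhs_ballP[e /= e0 HP]; exists e => // s sl ts; apply: HP.
by rewrite ballEmdist; apply: le_lt_trans ts; apply: dist_hpt.
Qed.

Lemma nbhsNclosed A q : closed A -> ~ A q -> nbhs q (~` A).
Proof. by move=> cA nAq; apply: open_nbhs_nbhs; split => //; apply: closed_openC. Qed.

Definition exits A nu (t : R) := \forall s \near 0^'+, ~ A (hpt nu (t + s)).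

Lemma exits_boundary A nu (t : R) : 0 <= t < len nu.1 -> A (hpt nu t) ->
  exits A nu t -> (closure A `\` interior A) (hpt nu t).
Proof.
move=> tl At ex; split; first exact: subset_closure.
rewrite /interior => /(near_hpt _)[|e e0 He]; first by lra.
have m0 : 0 < Num.min e (len nu.1 - t) by rewrite lt_min e0; lra.
have [s] := near0_ex m0 ex.
rewrite lt_min => /and3P[s0 se sl]; apply; apply: He; first by lra.
by rewrite opprD addNKr normrN gtr0_norm.
Qed.

Lemma outdegE A x : outdeg A x = #|[set nu in tangent x | `[< exits A nu (hpos x nu) >]]|.
Proof.
rewrite /outdeg; apply: eq_card => nu; rewrite !inE; case: (boolP (nu \in tangent x)) => //= nut.
apply/asbool_equiv_eq; rewrite /exits; split; apply: filterS => s; by rewrite advanceE.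
Qed.

(* A boundary point at which [A] is left has positive outdegree, hence lies in the
   support of [E]; so [A] is never left in an interval without such points. *)
Lemma exits_dichotomy A E : closed A ->
    (forall x, (closure A `\` interior A) x -> (outdeg A x)%:Z <= coeff x E) ->
  forall nu (t : R), 0 <= t < len nu.1 ->
    (\forall s \near 0^'+, A (hpt nu (t + s))) \/ exits A nu t.
Proof.
move=> cA HA nu t tl; have [t0 _] := andP tl.
have [b [/andP[tb bl] Db _]] := next_point (dom E) tl.
have [allA|/existsNP[y /not_implyP[ytb nAy]]] :=
    pselect (forall y, t < y < b -> A (hpt nu y)).
  by left; apply/near0P; exists (b - t) => [|s sb]; [lra|apply: allA; lra].
right; apply/near0P; exists (y - t) => [|s sy]; first by lra.
move=> As; pose U := [set u | t + s <= u <= y /\ A (hpt nu u)].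
have Us : U (t + s) by split => //; rewrite lexx; lra.
have Uub : ubound U y by move=> u [/andP[]].
have Usup : has_sup U by split; [exists (t + s)|exists y].
set a := sup U.
have sa : t + s <= a by apply: ub_le_sup => //; exists y.
have ay : a <= y by apply: ge_sup => //; exists (t + s).
have Aa : A (hpt nu a).
  apply: contrapT => /(nbhsNclosed cA) /near_hpt[|e e0 He]; first by lra.
  have [u Uu au] := sup_adherent e0 Usup.
  have ua : u <= a by apply: ub_le_sup => //; exists y.
  by case: Uu => usy; apply: He; [lra|rewrite ger0_norm; rewrite -/a in au *; lra].
have ay' : a < y by rewrite lt_neqAle ay andbT; apply/eqP => aE; rewrite aE in Aa.
have al : 0 <= a < len nu.1 by lra.
have exa : exits A nu a.
  apply/near0P; exists (y - a) => [|u ua Au]; first by lra.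
  suff : a + u <= a by lra.
  by apply: ub_le_sup; [exists y|split => //; lra].
have := HA _ (exits_boundary al Aa exa); rewrite coeff_outdom; last by apply: Db; lra.
rewrite outdegE lez_nat leqn0 cards_eq0 => /eqP/setP/(_ nu).
by rewrite !inE tangent_hpt// hpos_hpt//; case: asboolP.
Qed.

Section Fire.
Variables (A : set (curve_point G)) (E : {freeg (curve_point G)}) (p : curve_point G).
Hypothesis cA : closed A.
Hypothesis nAp : ~ A p.
Hypothesis E_ge0 : forall q, 0 <= coeff q E.
Hypothesis HA : forall x, (closure A `\` interior A) x -> (outdeg A x)%:Z <= coeff x E.

(* Twice the radius, so that the part of length [e] where [fire] has slope 1 never
   meets the one of a collar coming from the opposite direction. *)
Definition collar (e : R) nu (a : R) := [/\ 0 <= a, a + 2 * e <= len nu.1,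
  A (hpt nu a) & forall u, a < u < a + 2 * e -> ~ A (hpt nu u)].

Lemma collar_radius : exists e : R, [/\ 0 < e,
  forall nu a, 0 <= a < len nu.1 -> A (hpt nu a) -> exits A nu a -> collar e nu a &
  forall q, A q -> e <= path_dist p q].
Proof.
have /nbhs_ballP[e1 /= e10 He1] := nbhsNclosed cA nAp.
have : \forall s \near 0^'+, forall q, q \in dom E ->
    forall nu, nu \in tangent q -> exits A nu (hpos q nu) ->
    hpos q nu + s < len nu.1 /\ forall u, hpos q nu < u < hpos q nu + s -> ~ A (hpt nu u).
  apply: near0_seq => q _; apply: filter_forall => nu.
  have [nut|] := boolP (nu \in tangent q); last by move=> _; apply: nearW.
  have [/near0P[d d0 Hd]|] := pselect (exits A nu (hpos q nu)); last by move=> ?; apply: nearW.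
  have /andP[t0 tl] := hpos_itv nut.
  apply/near0P; exists (Num.min d (len nu.1 - hpos q nu)); first by rewrite lt_min d0 subr_gt0.
  move=> s; rewrite lt_min => /and3P[s0 sd sl] _ _; split; first by lra.
  by move=> u us; have := Hd (u - hpos q nu); rewrite subrKC; apply; lra.
move=> /(near0_ex e10)[s /andP[s0 se] Hs]; exists (s / 2); split; first by rewrite divr_gt0.
  move=> nu a al Aa exa; have /andP[a0 _] := al.
  have aS : hpt nu a \in dom E.
    rewrite mem_dom; apply/eqP => E0; have := HA (exits_boundary al Aa exa); rewrite E0.
    rewrite outdegE lez_nat leqn0 cards_eq0 => /eqP/setP/(_ nu).
    by rewrite !inE tangent_hpt// hpos_hpt//; case: asboolP.
  have := Hs _ aS nu (tangent_hpt al); rewrite hpos_hpt// => /(_ exa)[sl Hu].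
  have sE : 2 * (s / 2) = s by rewrite mulrC divfK.
  rewrite /collar sE; split => //; lra.
move=> q Aq; apply: (@le_trans _ _ e1); first by lra.
by rewrite leNgt; apply/negP => pq; apply: (He1 q).
Qed.

Section FireFunction.
Variable e : R.
Hypothesis e0 : 0 < e.
Hypothesis He : forall nu a, 0 <= a < len nu.1 -> A (hpt nu a) -> exits A nu a -> collar e nu a.
Hypothesis pA : forall q, A q -> e <= path_dist p q.

Definition in_collar q nu (a s : R) :=
  [/\ collar e nu a, 0 < s < e & q = hpt nu (a + s)].

(** Chip firing of [A] over a distance [e]: depth [e] on [A], slope 1 along each collar, 0 beyond.
    The default 0 of [xget] is the value beyond the collars; inside one, the value does not depend
    on the collar chosen. *)
Definition fire q : R :=
  if `[< A q >] then - e
  else xget 0 [set v | exists nu a s, in_collar q nu a s /\ v = s - e].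

Lemma in_collar_flip q nu (a s : R) : in_collar q nu a s ->
  [/\ 0 < a + s < len nu.1, ~ A q & q = hpt (flip nu) (len nu.1 - (a + s))].
Proof.
move=> [[a0 al Aa nA] sl ->]; split; [lra|apply: nA; lra|].
by rewrite hpt_flip subKr.
Qed.

(** Collars meeting in the same direction have the same base, since neither contains a point of [A].
    In opposite directions their bases would be less than [2 * e] apart, and one base would lie in
    the other collar. *)
Lemma in_collar_uniq q nu (a s : R) nu' (a' s' : R) :
  in_collar q nu a s -> in_collar q nu' a' s' -> s = s'.
Proof.
move=> [[a0 al Aa nA] sl qE] [[a0' al' Aa' nA'] sl' qE'].
have asl : 0 < a + s < len nu.1 by lra.
have asl' : 0 < a' + s' < len nu'.1 by lra.
have : nu' \in tangent q by rewrite qE' tangent_hpt//; lra.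
rewrite qE tangent_inner// !inE => /orP[] /eqP nuE; subst nu'.
  have EQ : a + s = a' + s'.
    by apply: (@hpt_inj _ _ nu); [lra|lra|rewrite -qE].
  have [aa|aa|aa] := ltgtP a a'; last by lra.
    by exfalso; apply: (nA a') => //; lra.
  by exfalso; apply: (nA' a) => //; lra.
have EQ : a + s = len nu.1 - (a' + s').
  apply: (@hpt_inj _ _ nu); [lra|rewrite /= in asl'; lra|].
  by rewrite -qE qE' hpt_flip.
exfalso; apply: (nA (len nu.1 - a')); first by rewrite /= in asl'; lra.
by rewrite -hpt_flip.
Qed.

Lemma fire_in q : A q -> fire q = - e.
Proof. by move=> Aq; rewrite /fire asboolT. Qed.

Lemma fire_collar q nu (a s : R) : in_collar q nu a s -> fire q = s - e.
Proof.
move=> qc; have [_ nAq _] := in_collar_flip qc; rewrite /fire asboolF//.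
case: xgetP => [v _ [nu' [a' [s' [qc' ->]]]]|/(_ (s - e)) none].
  by rewrite (in_collar_uniq qc qc').
by exfalso; apply: none; exists nu, a, s.
Qed.

Lemma fire_out q : ~ A q -> (forall nu a s, ~ in_collar q nu a s) -> fire q = 0.
Proof.
move=> nAq nc; rewrite /fire asboolF//; case: xgetP => // v _ [nu [a [s [qc _]]]].
by case: (nc nu a s).
Qed.

Lemma fire_le0 q : fire q <= 0.
Proof.
have [/fire_in->|nAq] := pselect (A q); first by rewrite oppr_le0 ltW.
have [[nu [a [s qc]]]|nc] := pselect (exists nu a s, in_collar q nu a s).
  by rewrite (fire_collar qc); case: qc => _ ? _; lra.
by rewrite fire_out// => nu a s qc; apply: nc; exists nu, a, s.
Qed.

Lemma fire_base : fire p = 0.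
Proof.
apply: fire_out => // nu a s [[a0 al Aa _] sl pE].
have := pA Aa; rewrite pE leNgt => /negP; apply.
apply: le_lt_trans (dist_hpt _ _) _; [lra|lra|].
by rewrite addrAC subrr add0r ger0_norm; lra.
Qed.

Lemma fire_germ_in nu (t : R) : 0 <= t < len nu.1 -> A (hpt nu t) ->
  germ fire nu t (`[< exits A nu t >] : nat)%:Z.
Proof.
move=> tl At; rewrite /germ; have [ex|nex] := asboolP (exits A nu t); last first.
  have [nA|//] := exits_dichotomy cA HA tl.
  by apply: filterS nA => s As; rewrite !fire_in// mul0r addr0.
have c := He tl At ex; apply/near0P; exists e => // s sl.
have /fire_collar-> : in_collar (hpt nu (t + s)) nu t s by split.
by rewrite fire_in// mul1r addrC.
Qed.

Lemma fire_germ_collar q nu (a s : R) : in_collar q nu a s ->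
  germ fire nu (a + s) 1 /\ germ fire (flip nu) (len nu.1 - (a + s)) (-1).
Proof.
move=> qc; have [c /andP[s0 se] qE] := qc; have := fire_collar qc; rewrite qE => fq.
have [asl _ _] := in_collar_flip qc.
split; rewrite /germ.
  apply/near0P; exists (e - s) => [|u ul]; first by lra.
  by rewrite fq (@fire_collar _ nu a (s + u)) ?addrA; [ring|split => //; [lra|rewrite addrA]].
apply/near0P; exists s => // u ul; rewrite !hpt_flip subKr fq.
have -> : len nu.1 - (len nu.1 - (a + s) + u) = a + (s - u) by ring.
by rewrite (@fire_collar _ nu a (s - u)); [rewrite rmorphN/=; ring|split => //; lra].
Qed.

Lemma fire_germ_out nu (t : R) : 0 <= t < len nu.1 -> ~ A (hpt nu t) ->
  (forall nu' a s, ~ in_collar (hpt nu t) nu' a s) -> exists k, germ fire nu t k.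
Proof.
move=> tl nAt nc; have ft := fire_out nAt nc.
have [t0 tl'] := andP tl.
have [|d d0 Hd] := near_hpt _ (nbhsNclosed cA nAt); first by lra.
(* A collar meeting the right of [t] comes from the opposite direction. *)
have opp u nu' a s : 0 < u < d -> u < len nu.1 - t -> in_collar (hpt nu (t + u)) nu' a s ->
    [/\ nu' = flip nu, collar e (flip nu) a, 0 < s < e, t + u + s = len nu.1 - a &
      t <= len nu.1 - a - e].
  move=> ud ul [c sl qE]; have [a0 al Aa nA] := c.
  have tul : 0 < t + u < len nu.1 by lra.
  have : nu' \in tangent (hpt nu (t + u)) by rewrite qE tangent_hpt//; lra.
  rewrite tangent_inner// !inE => /orP[] /eqP nuE; subst nu'.
    have tuE : t + u = a + s by apply: (@hpt_inj _ _ nu); [lra|lra|rewrite -qE].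
    have [ta|at_] := leP t a.
      exfalso; apply: (Hd a) => //; first by lra.
      by rewrite distrC ger0_norm; lra.
    exfalso; apply: (nc nu a (t - a)); split => //; first by lra.
    by rewrite subrKC.
  rewrite /= in al.
  have tuE : t + u = len nu.1 - (a + s).
    by apply: (@hpt_inj _ _ nu); [lra|lra|rewrite qE hpt_flip].
  split => //; first by lra.
  rewrite leNgt; apply/negP => ta; apply: (nc (flip nu) a (len nu.1 - a - t)); split => //.
    by lra.
  by rewrite hpt_flip; congr hpt; ring.
(* If [t] is the outer end of a collar ahead, the function descends at once with slope -1; otherwise
   it stays 0 for a while. *)
have [[a [c tE]]|none] := pselect (exists a, collar e (flip nu) a /\ t = len nu.1 - a - e).
  exists (-1); apply/near0P; exists (Num.min e (Num.min d (len nu.1 - t))).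
    by rewrite !lt_min e0 d0 subr_gt0.
  move=> u; rewrite !lt_min => /and4P[u0 ue ud ul].
  rewrite ft (@fire_collar _ (flip nu) a (e - u)); first by rewrite rmorphN/=; ring.
  split => //; first by lra.
  by rewrite hpt_flip tE; congr hpt; ring.
exists 0.
(* [r] is the distance to the outer end of a collar ahead if one lies within [e], and [e] otherwise.
   Two different such ends cannot lie that close, as one base would fall into the other collar. *)
have [r r0 Hr] : exists2 r : R, 0 < r & forall a, collar e (flip nu) a ->
    t < len nu.1 - a - e -> t + r <= len nu.1 - a - e.
  have [[a [c ta]]|none'] := pselect (exists a, collar e (flip nu) a /\ t < len nu.1 - a - e < t + e).
    exists (len nu.1 - a - e - t); first by lra.
    move=> a' c' ta'; rewrite leNgt; apply/negP => aa'.
    have [a0' al' Aa' nA'] := c'; have [a0 al Aa nA] := c.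
    by apply: (nA a') => //; lra.
  exists e => // a c ta; rewrite leNgt; apply/negP => ta'; apply: none'.
  by exists a; split => //; rewrite ta; lra.
apply/near0P; exists (Num.min r (Num.min d (len nu.1 - t))).
  by rewrite !lt_min r0 d0 subr_gt0.
move=> u; rewrite !lt_min => /and4P[u0 ur ud ul].
rewrite ft mul0r addr0 fire_out//.
  by apply: Hd; [lra|rewrite opprD addNKr normrN gtr0_norm].
move=> nu' a s /opp; rewrite u0 ud => /(_ isT ul)[_ c sl tuE].
rewrite le_eqVlt => /predU1P[tE|/(Hr _ c)]; last by lra.
by apply: none; exists a.
Qed.

Lemma fire_PL : PL fire.
Proof.
move=> nu t tl; have [At|nAt] := pselect (A (hpt nu t)).
  by eexists; apply: fire_germ_in.
have [[nu' [a [s qc]]]|nc] := pselect (exists nu' a s, in_collar (hpt nu t) nu' a s); last first.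
  by apply: fire_germ_out => // nu' a s qc; apply: nc; exists nu', a, s.
have [asl _ _] := in_collar_flip qc; have [g1 g2] := fire_germ_collar qc.
have [_ _ tE] := qc.
have : nu \in tangent (hpt nu t) by rewrite tangent_hpt.
rewrite {1}tE tangent_inner// !inE => /orP[] /eqP nuE; subst nu.
  have -> : t = a + s by apply: (@hpt_inj _ _ nu'); [lra|lra|].
  by exists 1.
have -> : t = len nu'.1 - (a + s).
  apply: (@hpt_inj _ _ (flip nu')); [by []|rewrite /=; lra|].
  by rewrite tE hpt_flip subKr.
by exists (-1).
Qed.

Lemma fire_lap_in x : A x -> lap fire x = (outdeg A x)%:Z.
Proof.
move=> Ax; rewrite outdegE -sum1_card (big_morph Posz PoszD erefl).
transitivity (\sum_(nu in tangent x) (`[< exits A nu (hpos x nu) >] : nat)%:Z).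
  apply: eq_bigr => nu nut; apply/slE/fire_germ_in; first exact: hpos_itv.
  by rewrite hposK.
under eq_bigl do rewrite inE.
by rewrite big_mkcondr; apply: eq_bigr => nu _; case: asbool.
Qed.

(** On [A] the Laplacian is the outdegree, which vanishes if there is no exit and is bounded by [HA]
    otherwise. Inside a collar it is 0. At any other point [fire] takes its maximal value 0, so all
    slopes are nonpositive. *)
Lemma fire_lap x : lap fire x <= coeff x E.
Proof.
have [Ax|nAx] := pselect (A x).
  rewrite (fire_lap_in Ax).
  have [[nu nut ex]|nex] := pselect (exists2 nu, nu \in tangent x & exits A nu (hpos x nu)).
    apply: HA; rewrite -(hposK nut); apply: exits_boundary => //; first exact: hpos_itv.
    by rewrite hposK.
  rewrite outdegE (_ : [set nu in _ | _]%SET = finset.set0) ?cards0//.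
  apply/setP => nu; rewrite !inE; apply/negP => /andP[nut /asboolP ex].
  by apply: nex; exists nu.
apply: le_trans (E_ge0 x).
have [[nu' [a [s qc]]]|nc] := pselect (exists nu' a s, in_collar x nu' a s).
  have [asl _ _] := in_collar_flip qc; have [g1 g2] := fire_germ_collar qc.
  by case: qc => _ _ ->; rewrite lap_inner// (slE g1) (slE g2).
have fx : fire x = 0 by apply: fire_out => // nu a s qc; apply: nc; exists nu, a, s.
apply: sumr_le0 => nu nut; apply: sl_cst_le0 => //; [exact: fire_PL|exact: hpos_itv|].
by apply: nearW => s; rewrite hposK// fx fire_le0.
Qed.

End FireFunction.

End Fire.

Lemma lowest_reduced D E p : (exists f, linsys D f) ->
  (forall q, coeff q E = coeff q D - lap (lowest D p) q) -> is_reduced p E.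
Proof.
move=> D0 EE; have LD := lowest_linsys p D0; have [LPL Llap] := LD.
have E_ge0 q : 0 <= coeff q E by rewrite EE subr_ge0.
split=> [q _ //|A [x Ax] _ cA nAp].
apply: contrapT => none.
have HA y : (closure A `\` interior A) y -> (outdeg A y)%:Z <= coeff y E.
  by move=> yA; rewrite leNgt; apply/negP => h; apply: none; exists y.
have [e [e0 He pA]] := collar_radius cA nAp HA.
have fPL := fire_PL cA HA e0 He.
have : linsys D (fun q => lowest D p q + fire A e q).
  split=> [|q]; first exact: PLD.
  rewrite lapD//; have := fire_lap cA E_ge0 HA e0 He q; rewrite EE; lia.
move=> /(lowest_le p D0 x); rewrite lowest_base// (fire_base nAp pA) (fire_in _ Ax).
lra.
Qed.

End Firing.

(** * The coefficient of the reduced divisor at its base point *)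

Section ReducedCoefficient.
Context {R : realType} {G : tropicalCurve R}.
Implicit Types (p q x : curve_point G) (nu : edge G * bool) (f g : curve_point G -> R).
Implicit Types (D E : {freeg (curve_point G)}).

Lemma connected_hpt_segment nu (a b : R) : 0 <= a -> b <= len nu.1 ->
  connected (hpt nu @` `[a, b]).
Proof.
move=> a0 bl.
(* [dist_hpt] speaks of parameters in [[0, len]]; clamping yields a 1-Lipschitz map on the whole
   line. *)
pose clamp (t : R) := Num.max 0 (Num.min t (len nu.1)).
have l0 := len_gt0 nu.1.
have clampE t : 0 <= t <= len nu.1 -> clamp t = t.
  by move=> /andP[t0 tl]; rewrite /clamp min_l// max_r.
have clamp_itv t : 0 <= clamp t <= len nu.1.
  by rewrite /clamp le_max lexx/= ge_max ltW//= ge_min lexx orbT.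
have clamp_lip s t : `|clamp s - clamp t| <= `|s - t|.
  have n1 : s - t <= `|s - t| by apply: ler_norm.
  have n2 : t - s <= `|s - t| by rewrite distrC ler_norm.
  move: `|s - t| n1 n2 => n n1 n2; rewrite /clamp; move: (len nu.1) l0 => L l0.
  rewrite ler_norml; case: (leP s L) => hs; case: (leP t L) => ht;
    rewrite ?(max_r (ltW l0)); try (case: (leP 0 s) => ?); try (case: (leP 0 t) => ?);
    apply/andP; split; lra.
have -> : hpt nu @` `[a, b] = (fun t => hpt nu (clamp t)) @` `[a, b].
  by apply: eq_imagel => t /=; rewrite in_itv/= => tab; rewrite clampE//; lra.
apply: connected_continuous_connected; first exact: segment_connected.
apply: continuous_subspaceT => t P /nbhs_ballP[e /= e0 HP].
apply/nbhs_ballP; exists e => //= s; rewrite /ball/= => ts; apply: HP.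
rewrite ballEmdist; apply: le_lt_trans ts; apply: le_trans (clamp_lip _ _).
exact: dist_hpt.
Qed.

Lemma PL_argmin f : PL f -> exists m, forall q, f m <= f q.
Proof.
move=> fPL; have [ts H] := rational_partition (PL_rational fPL).
pose L : seq (curve_point G) :=
  flatten [seq [seq pt e t | t <- 0 :: ts e] | e <- enum (edge G)].
have inL e t : t \in 0 :: ts e -> pt e t \in L.
  move=> tts; apply/flattenP; exists [seq pt e t | t <- 0 :: ts e]; last exact: map_f.
  by apply/mapP; exists e; rewrite ?mem_enum.
have Lmin q : exists2 l, l \in L & f l <= f q.
  have [e [t [tl ->]]] := ptP q; have [p0 l0 A] := H e.
  rewrite in_itv/= in tl.
  have [t0|t0] := eqVneq t 0; first by exists (pt e 0); rewrite ?t0// inL// mem_head.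
  have [|i its tit] := @path_piece_left _ 0 (ts e) t p0.
    by rewrite l0 lt_neqAle eq_sym t0.
  have [k [c E]] := A i its.
  have aL : pt e (nth 0 (0 :: ts e) i) \in L by apply/inL/mem_nth; rewrite /= ltnW.
  have bL : pt e (nth 0 (ts e) i) \in L by apply: inL; rewrite in_cons mem_nth ?orbT.
  have [k0|k0] := leP 0 k.
    exists (pt e (nth 0 (0 :: ts e) i)) => //.
    rewrite !E ?in_itv/=; try lra.
    by rewrite lerD2r ler_wpM2l ?ler0z//; lra.
  exists (pt e (nth 0 (ts e) i)) => //.
  rewrite !E ?in_itv/=; try lra.
  by rewrite lerD2r ler_wnM2l ?lerz0//; [exact: ltW|lra].
have [e0 _] := card_gt0P (edge_nonempty G).
have [m mL Hm] := @seq_argmin _ _ _ f L _ (inL e0 0 (mem_head _ _)).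
by exists m => q; have [l /Hm ml lq] := Lmin q; apply: le_trans ml lq.
Qed.

(** Write [E = D + div f] and let [h = F - f] with [F] the lowest function. At a minimum of [h] all
    its slopes are nonnegative, and at an exit from a component [A] of the minimum set they are at
    least 1. If the minimum were not attained at [p], reducedness would give a boundary point of [A]
    with [lap h >= outdeg > E], against [D + div F >= 0]. Hence [lap f p <= lap F p], so [f] is in
    the system, and the minimality of [F] gives the converse inequality. *)
Lemma reduced_coeff D E p : (exists f, linsys D f) ->
  is_reduced p E -> lin_equiv D E ->
  coeff p E = coeff p D - lap (lowest D p) p.
Proof.
move=> D0 [E_ge0 Ered] /lin_equivP[f fPL fE].
have LD := lowest_linsys p D0; have [LPL Llap] := LD.
set F := lowest D p in LD LPL Llap *.
have FNPL := PLN fPL.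
pose h q := F q + - f q; have hPL : PL h by apply: PLD.
have lapF q : lap F q = lap f q + lap h q by rewrite lapD// lapN//; ring.
have [m Hm] := PL_argmin hPL.
pose M := [set q | h q = h m].
have sl_h q nu : M q -> nu \in tangent q -> 0 <= sl h nu (hpos q nu).
  move=> Mq nut; apply: sl_ge0 => //; first exact: hpos_itv.
  by apply: nearW => s; rewrite hposK// Mq.
have Mp : M p.
  apply: contrapT => nMp.
  have cM : closed M.
    apply: (@preimage_closed _ _ h [set h m]); last exact: closed_eq.
    by move=> q _; apply: PL_continuous.
  pose A := connected_component M m.
  have Am : A m by apply: connected_component_refl.
  have AM : A `<=` M by apply: connected_component_sub.
  have cA : closed A by apply: component_closed.
  have [||||x [+ _] xE] := Ered A.
  - by exists m.
  - exact: component_connected.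
  - exact: cA.
  - by move=> /AM.
  rewrite -(closure_id A).1// => Ax; have Mx := AM _ Ax.
  have := Llap x; rewrite leNgt => /negP; apply.
  have -> : coeff x D = coeff x E + lap f x by rewrite fE; ring.
  rewrite lapF addrC ltrD2l; apply: lt_le_trans xE _.
  rewrite outdegE -sum1_card (big_morph Posz PoszD erefl).
  under eq_bigl do rewrite inE.
  rewrite big_mkcondr; apply: ler_sum => nu nut.
  have := sl_h x nu Mx nut; case: asboolP => // ex; rewrite le_eqVlt => /predU1P[s0|//].
  (* Along a direction of slope 0, [h] stays minimal on a short segment from [x]. That segment is
     connected, hence inside [A], so the direction is not an exit. *)
  have ht : \forall s \near 0^'+, h (hpt nu (hpos x nu + s)) = h x.
    by apply: filterS (PL_tangent hPL nut) => s ->; rewrite -s0 mul0r addr0.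
  have /near0P[d d0 Hd] := ht.
  have /andP[xt0 xtl] := hpos_itv nut.
  have [|s /andP[s0' sd] nAs] := @near0_ex _ _ (Num.min d (len nu.1 - hpos x nu)) _ ex.
    by rewrite lt_min d0 subr_gt0.
  rewrite lt_min in sd; have /andP[sd1 sd2] := sd.
  exfalso; apply: nAs; apply: (connected_component_trans Ax).
  exists (hpt nu @` `[hpos x nu, hpos x nu + s]).
    split; last by apply: connected_hpt_segment => //; lra.
      by exists (hpos x nu); rewrite ?hposK//= in_itv/= lexx; lra.
    move=> _ [t /= tE <-]; rewrite in_itv/= in tE.
    have [->|tx] := eqVneq t (hpos x nu); first by rewrite hposK.
    rewrite /M /= -Mx -(Hd (t - hpos x nu)) ?subrKC//.
    have : hpos x nu < t by rewrite lt_neqAle eq_sym tx; case/andP: tE.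
    lra.
  by exists (hpos x nu + s) => //=; rewrite in_itv/= lexx; lra.
have le1 : lap f p <= lap F p.
  by rewrite lapF lerDl; apply: sumr_ge0 => nu; apply: sl_h.
have fD : linsys D f.
  split=> // q; have [->|qp] := eqVneq q p; first exact: le_trans (Llap p).
  by have := E_ge0 q qp; rewrite fE subr_ge0.
have le2 : lap F p <= lap f p.
  apply: ler_sum => nu nut; apply: sl_le => //; first exact: hpos_itv.
  apply: nearW => s; rewrite hposK// /F lowest_base// subr0.
  exact: lowest_le.
by rewrite fE; lia.
Qed.

Lemma coeff_reduced_divisor D p : (exists f, linsys D f) ->
  coeff p (reduced_divisor p D) = coeff p D - lap (lowest D p) p.
Proof.
move=> D0; rewrite /reduced_divisor; case: xgetP => [E _ [Ered DE]|none].
  exact: reduced_coeff.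
(* The default of [xget] is excluded: [D + div (lowest D p)] is a reduced representative. *)
have LD := lowest_linsys p D0.
have [L HL] := lap_divisor LD.1; exfalso; apply: (none (D - L)); split.
  by apply: (lowest_reduced D0) => q; rewrite coeffB HL.
by apply/lin_equivP; exists (lowest D p); [case: LD|move=> q; rewrite coeffB HL].
Qed.

(** Lying below every [f - f p] and equal to it at [p], the lowest function has the least slopes at
    [p], so it brings the most chips there. *)
Lemma linsys_sub_lowest D p (j : int) : 0 <= j -> (exists f, linsys D f) ->
  (exists f, linsys (D - << j *g p >>) f) <-> j <= coeff p D - lap (lowest D p) p.
Proof.
move=> j0 D0; have [LPL Llap] := lowest_linsys p D0; split=> [[f fDj]|jle].
  have fD : linsys D f.
    by apply: linsys_le fDj => q; rewrite coeff_subU; case: eqP; lia.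
  have := fDj.2 p; rewrite coeff_subU eqxx.
  suff : lap (lowest D p) p <= lap f p by lia.
  apply: ler_sum => nu nut; apply: sl_le => //; [exact: fD.1|exact: hpos_itv|].
  apply: nearW => s; rewrite hposK// lowest_base// subr0.
  exact: lowest_le.
exists (lowest D p); split=> // q; rewrite coeff_subU.
by case: eqP => [<-|_]; [lia|rewrite subr0].
Qed.

Lemma sl_lowest_le D p f nu : linsys D f -> nu \in tangent p ->
  sl (lowest D p) nu (hpos p nu) <= sl f nu (hpos p nu).
Proof.
move=> fD nut; have D0 : exists f, linsys D f by exists f.
have [LPL _] := lowest_linsys p D0.
apply: sl_le => //; [exact: fD.1|exact: hpos_itv|].
apply: nearW => s; rewrite hposK// lowest_base// subr0.
exact: lowest_le.
Qed.

End ReducedCoefficient.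

(** * Gathering chips near a point, and isolated points of the locus *)

Section IsolatedPoint.
Context {R : realType} {G : tropicalCurve R}.
Implicit Types (p q x : curve_point G) (f g : curve_point G -> R).
Implicit Types (D E : {freeg (curve_point G)}).

Lemma affine_germ_flip f (nu : edge G * bool) (a b : R) (k : int) (c : R) :
  (forall t, a <= t <= b -> f (hpt nu t) = k%:~R * t + c) ->
  forall t, a < t <= b -> germ f (flip nu) (len nu.1 - t) (- k).
Proof.
move=> H t tab; apply: (@affine_germ _ _ f (flip nu) (len nu.1 - b) (len nu.1 - a)
  (- k) (c + k%:~R * len nu.1)) => [s sl|]; last by lra.
by rewrite hpt_flip H; [rewrite rmorphN/=; ring|lra].
Qed.

Lemma half_edge_eq (nu nu' : edge G * bool) : nu'.1 = nu.1 -> nu' = nu \/ nu' = flip nu.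
Proof.
case: nu nu' => e b [e' b'] /= ->; rewrite /flip /=.
by case: b; case: b'; [left|right|right|left].
Qed.

Section Tent.
Variables (f : curve_point G -> R) (nu : edge G * bool) (t c tau : R) (k v : int).
Hypothesis t0 : 0 <= t.
Hypothesis ttau : t < tau.
Hypothesis tauc : tau <= c.
Hypothesis cl : c < len nu.1.
Hypothesis fPL : PL f.

Let L1 s : R := f (hpt nu t) + k%:~R * (s - t).
Let L2 s : R := f (hpt nu c) + v%:~R * (s - c).
Hypothesis crossing : L1 tau = L2 tau.

Local Ltac tlra := have := t0; have := ttau; have := tauc; have := cl; lra.

(** Between [t] and [c], [f] is replaced by the line of slope [k] from its value at [t] followed by
    the line of slope [v] into its value at [c]. With [v] the slope of [f] beyond [c], no bend
    remains at [c], and the only one in [(t, c]] is at [tau]. *)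
Definition tent q : R :=
  if (nu \in tangent q) && (t < hpos q nu < c) then
    if hpos q nu <= tau then L1 (hpos q nu) else L2 (hpos q nu)
  else f q.

Lemma tent_out q : (forall s, t < s < c -> q <> hpt nu s) -> tent q = f q.
Proof.
rewrite /tent => H; case: ifP => // /andP[qt qtc].
by exfalso; apply: (H _ qtc); rewrite hposK.
Qed.

Lemma tent_outside s : 0 <= s <= len nu.1 -> s <= t \/ c <= s -> tent (hpt nu s) = f (hpt nu s).
Proof.
move=> /andP[s0 sl] sout; rewrite /tent; case: ifP => // /andP[qt].
have pos_s : hpos (hpt nu s) nu = s \/ hpos (hpt nu s) nu = 0.
  move: sl; rewrite le_eqVlt => /predU1P[->|sl]; last by left; rewrite hpos_hpt// s0.
  by right; rewrite hpt_len.
by case: pos_s sout => -> [] ? ?; exfalso; tlra.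
Qed.

Lemma tent_L1 s : t <= s <= tau -> tent (hpt nu s) = k%:~R * s + (f (hpt nu t) - k%:~R * t).
Proof.
move=> stau; have sl : 0 <= s < len nu.1 by tlra.
have [->|ts] := eqVneq s t; first by rewrite tent_outside; [ring|tlra|left].
have [sc|sc] := eqVneq s c.
  have E : tau = c by tlra.
  by rewrite sc tent_outside; [move: crossing; rewrite /L1 /L2 E; tlra|tlra|right].
rewrite /tent tangent_hpt// hpos_hpt//= lt_neqAle eq_sym ts lt_neqAle sc/=.
have -> : (t <= s) && (s <= c) by tlra.
by case/andP: stau => _ ->; rewrite /L1; ring.
Qed.

Lemma tent_L2 s : tau <= s <= c -> tent (hpt nu s) = v%:~R * s + (f (hpt nu c) - v%:~R * c).
Proof.
move=> stau; have sl : 0 <= s < len nu.1 by tlra.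
have [->|sc] := eqVneq s c; first by rewrite tent_outside; [ring|tlra|right].
rewrite /tent tangent_hpt// hpos_hpt//=.
have sc' : s < c by rewrite lt_neqAle sc/=; tlra.
have -> : t < s < c by tlra.
case: (ltgtP s tau) => [h|_|->]; [by exfalso; tlra|by rewrite /L2; ring|].
by rewrite crossing /L2; ring.
Qed.

(** Germs look forward: along [nu] the end [c] is already off the tent while [t] is not, and along
    [flip nu] the roles are exchanged. *)
Definition off_tent (nu' : edge G * bool) (s : R) :=
  [\/ nu'.1 != nu.1, nu' = nu /\ (s < t \/ c <= s) |
      nu' = flip nu /\ (s < len nu.1 - c \/ len nu.1 - t <= s)].

Lemma tent_germ_off nu' s m : 0 <= s < len nu'.1 -> off_tent nu' s ->
  germ f nu' s m -> germ tent nu' s m.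
Proof.
move=> sl off; have near_f : exists2 d : R, 0 < d &
    forall u, 0 <= u < d -> tent (hpt nu' (s + u)) = f (hpt nu' (s + u)).
  case: off => [ne|[E sE]|[E sE]]; last 2 first.
  - subst nu'; case: sE => sE.
      by exists (t - s) => [|u ud]; [tlra|apply: tent_outside; [tlra|left; tlra]].
    exists (len nu.1 - s) => [|u ud]; first by tlra.
    by apply: tent_outside; [tlra|right; tlra].
  - subst nu'; rewrite /= in sl; case: sE => sE.
      exists (len nu.1 - c - s) => [|u ud]; first by tlra.
      by rewrite hpt_flip; apply: tent_outside; [tlra|right; tlra].
    exists (len nu.1 - s) => [|u ud]; first by tlra.
    by rewrite hpt_flip; apply: tent_outside; [tlra|left; tlra].
  exists (len nu'.1 - s) => [|u ud]; first by tlra.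
  apply: tent_out => w wtc E.
  have : nu' \in tangent (hpt nu' (s + u)) by apply: tangent_hpt; tlra.
  rewrite E tangent_inner; last by tlra.
  by rewrite !inE => /orP[] /eqP nuE; rewrite nuE eqxx in ne.
have [d d0 Hd] := near_f => gf.
apply: (germ_ext _ _ gf); first by have := Hd 0; rewrite addr0 => ->//; rewrite lexx.
by apply/near0P; exists d => // u ud; rewrite Hd//; tlra.
Qed.

Lemma tent_germ1 s : t <= s < tau -> germ tent nu s k.
Proof. exact: affine_germ tent_L1 s. Qed.

Lemma tent_germ2 s : tau <= s < c -> germ tent nu s v.
Proof. exact: affine_germ tent_L2 s. Qed.

Lemma tent_germ1_flip s : t < s <= tau -> germ tent (flip nu) (len nu.1 - s) (- k).
Proof. exact: affine_germ_flip tent_L1 s. Qed.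

Lemma tent_germ2_flip s : tau < s <= c -> germ tent (flip nu) (len nu.1 - s) (- v).
Proof. exact: affine_germ_flip tent_L2 s. Qed.

Lemma tent_PL : PL tent.
Proof.
move=> nu' s sL; have [off|on] := pselect (off_tent nu' s).
  by exists (sl f nu' s); apply: tent_germ_off => //; apply: PL_germ.
have [ne|nuE] := eqVneq nu'.1 nu.1; last by exfalso; apply: on; constructor 1.
have [E|E] := half_edge_eq ne.
- subst nu'; have [st|ts] := ltP s t; first by exfalso; apply: on; constructor 2; split; [|left].
  have [cs|sc] := leP c s; first by exfalso; apply: on; constructor 2; split; [|right].
  have [s1|s1] := ltP s tau; first by exists k; apply: tent_germ1; rewrite ts.
  by exists v; apply: tent_germ2; rewrite s1.
- subst nu'.
  have [st|ts] := ltP s (len nu.1 - c); first by exfalso; apply: on; constructor 3; split; [|left].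
  have [cs|sc] := leP (len nu.1 - t) s; first by exfalso; apply: on; constructor 3; split; [|right].
  rewrite -[s](subKr (len nu.1)).
  have [s1|s1] := leP (len nu.1 - s) tau; first by exists (- k); apply: tent_germ1_flip; tlra.
  by exists (- v); apply: tent_germ2_flip; tlra.
Qed.

Hypothesis slc : sl f nu c = v.

Lemma tent_lap_tau : lap tent (hpt nu tau) = v - k.
Proof.
rewrite lap_inner; last by tlra.
rewrite (slE (tent_germ1_flip _)); last by tlra.
congr (_ - _); have [E|E] := eqVneq tau c; last by apply/slE/tent_germ2; tlra.
rewrite E -slc; apply/slE/tent_germ_off; [tlra|by constructor 2; split; [|right]|].
by apply: PL_germ => //; tlra.
Qed.

Lemma tent_lap_inner s : t < s <= c -> s != tau -> lap tent (hpt nu s) = 0.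
Proof.
move=> sL stau; rewrite lap_inner; last by tlra.
have [s1|s1] := ltP s tau.
  by rewrite (slE (tent_germ1 _)) ?(slE (tent_germ1_flip _)) ?subrr//; tlra.
have s2 : tau < s by rewrite lt_neqAle eq_sym stau.
rewrite (slE (tent_germ2_flip _)); last by tlra.
suff -> : sl tent nu s = v by rewrite subrr.
have [E|E] := eqVneq s c; last by apply/slE/tent_germ2; tlra.
rewrite E -slc; apply/slE/tent_germ_off; [tlra|by constructor 2; split; [|right]|].
by apply: PL_germ => //; tlra.
Qed.

Lemma tent_lap_start : lap tent (hpt nu t) = lap f (hpt nu t) + (k - sl f nu t).
Proof.
have tl : 0 <= t < len nu.1 by tlra.
have nut := tangent_hpt tl.
rewrite /lap !(bigD1 nu nut)/= hpos_hpt// (slE (tent_germ1 _)); last by rewrite lexx.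
set A := \sum_(_ | _) _; set B := \sum_(_ | _) _; suff -> : A = B by ring.
apply: eq_bigr => nu' /andP[nut' ne]; apply/slE/tent_germ_off; first exact: hpos_itv.
  have [E|E] := eqVneq nu'.1 nu.1; last by constructor 1.
  have nuE : nu' = flip nu by case: (half_edge_eq E) ne => ->; rewrite ?eqxx.
  constructor 3; split => //.
  have [tE|tN] := eqVneq t 0; first by left; rewrite tE hpt0/=; tlra.
  by right; rewrite nuE hpos_flip ?lexx//; tlra.
by apply: PL_germ => //; apply: hpos_itv.
Qed.

Lemma tent_lap_off q : q != hpt nu t -> (forall s, t < s <= c -> q != hpt nu s) ->
  lap tent q = lap f q.
Proof.
move=> qt qs; apply: eq_bigr => nu' nut'; have ql := hpos_itv nut'.
apply/slE/tent_germ_off => //; last by apply: PL_germ.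
have [E|E] := eqVneq nu'.1 nu.1; last by constructor 1.
have [nuE|nuE] := eqVneq nu' nu.
  subst nu'; constructor 2; split => //.
  have qE := hposK nut'; rewrite -qE in qt qs.
  have [?|h] := ltP (hpos q nu) t; [by left|right].
  rewrite leNgt; apply/negP => h'; have [E'|E'] := eqVneq (hpos q nu) t.
    by rewrite E' eqxx in qt.
  by have := qs (hpos q nu); rewrite eqxx => /(_ _); rewrite lt_neqAle eq_sym E' h ltW// => /(_ isT).
have nuE' : nu' = flip nu by case: (half_edge_eq E) nuE => ->; rewrite ?eqxx.
subst nu'; constructor 3; split => //.
have qE := hposK nut'; rewrite hpt_flip in qE; rewrite -qE in qt qs.
set s := len nu.1 - hpos q (flip nu) in qt qs.
have hE : hpos q (flip nu) = len nu.1 - s by rewrite /s; ring.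
rewrite hE; have [?|h] := leP s t; [by right; tlra|left].
have [?|h'] := ltP c s; first by tlra.
by have := qs s; rewrite eqxx h h' => /(_ isT).
Qed.

End Tent.

(** The chip at [c] and concavity give [v + 1 <= u], where [u] and [v] are the slopes of [f] at [t]
    and [c]. The [r] spare chips at [t] pay for raising the initial slope to [k = u + r]. The bend
    at [tau] is then [v - k <= - (r + 1)]. As [tau] may be [c] but not [t], the chips are gathered
    away from [t]. *)
Lemma tent_divisor D (r : nat) (nu : edge G * bool) (t b c : R) :
    0 <= t -> t < c < b -> b <= len nu.1 ->
    (forall s, t < s < b -> hpt nu s \notin dom D) ->
    (exists f, linsys (D - << r%:Z *g hpt nu t >> - << hpt nu c >>) f) ->
  exists2 tau : R, t < tau <= c & exists F, linsys (D - << r.+1%:Z *g hpt nu tau >>) F.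
Proof.
move=> t0 /andP[tc cb] bl Db [f [fPL Hf]].
have tl : 0 <= t < len nu.1 by lra.
have cl : 0 < c < len nu.1 by lra.
have tcN s : t < s < len nu.1 -> (hpt nu t == hpt nu s) = false.
  move=> sL; apply/eqP => /hpt_inj E; suff : t = s by lra.
  by apply: E => //; lra.
have D0 s : t < s < b -> coeff (hpt nu s) D = 0 by move=> /Db/coeff_outdom.
have lap0 s : t < s < b -> lap f (hpt nu s) <= 0.
  move=> sb; apply: le_trans (Hf _) _; rewrite !coeff_subU D0// tcN; last by lra.
  by case: eqP.
set u := sl f nu t; set v := sl f nu c; set w := sl f (flip nu) (len nu.1 - c).
have vw : v + w <= -1.
  have := Hf (hpt nu c); rewrite lap_inner// !coeff_subU D0 ?tc// eqxx tcN; last by lra.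
  by rewrite subr0 sub0r.
have uw : - u <= w.
  apply: (@concave_slopes_flip _ _ f nu t b) => //; lra.
have fc : f (hpt nu c) <= f (hpt nu t) + u%:~R * (c - t).
  by apply: (@concave_le _ _ f nu t b) => //; lra.
have ft : f (hpt nu t) <= f (hpt nu c) + w%:~R * (c - t).
  have := @concave_le _ _ f (flip nu) (len nu.1 - c) (len nu.1 - t) fPL.
  rewrite /= => /(_ _ _ _ (len nu.1 - t) _); rewrite !hpt_flip !subKr -/w => H.
  apply: le_trans (H _ _ _ _) _; [lra|lra| |lra|].
    by move=> s sl; rewrite hpt_flip lap0//; lra.
  by have -> : len nu.1 - t - (len nu.1 - c) = c - t by ring.
have uv : v + 1 <= u by lia.
pose k : int := u + r%:Z.
have ku : k - u = r%:Z by rewrite /k addrC addKr.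
have vk : v - k <= 0 - r.+1%:Z by rewrite /k; lia.
have [tc0 wR uR kR] : [/\ 0 < c - t, w%:~R <= - 1 - v%:~R :> R, u%:~R <= k%:~R :> R &
    1 <= k%:~R - v%:~R :> R].
  split; first by lra.
  - have : (v + w)%:~R <= (-1)%:~R :> R by rewrite ler_int.
    by rewrite rmorphD rmorphN1 /=; lra.
  - by rewrite ler_int; lia.
  - by rewrite -rmorphB ler1z; lia.
(* The height at [t] of the line of slope [v] through the value at [c], above the value of [f] at
   [t]. The two lines approach at rate [k - v], so they cross at [t + N / (k - v)]. *)
pose N := f (hpt nu c) - f (hpt nu t) - v%:~R * (c - t).
have N1 : c - t <= N by have := ler_wpM2r (ltW tc0) wR; rewrite /N; lra.
have N2 : N <= (c - t) * (k%:~R - v%:~R).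
  by have := ler_wpM2r (ltW tc0) uR; rewrite /N; lra.
have den0 : 0 < k%:~R - v%:~R :> R by lra.
pose tau := t + N / (k%:~R - v%:~R).
have tauE : (tau - t) * (k%:~R - v%:~R) = N.
  by rewrite /tau addrAC subrr add0r divfK// gt_eqF.
have ttau : t < tau by rewrite /tau ltrDl divr_gt0//; lra.
have tauc : tau <= c.
  have : N / (k%:~R - v%:~R) <= c - t by rewrite ler_pdivrMr.
  by rewrite /tau; lra.
have crossing : f (hpt nu t) + k%:~R * (tau - t) = f (hpt nu c) + v%:~R * (tau - c).
  by move: tauE; rewrite /N; lra.
have cl' : c < len nu.1 by lra.
exists tau; first by rewrite ttau.
exists (tent f nu t c tau k v); split; first exact: tent_PL.
move=> q; rewrite coeff_subU.
have [->|qt] := eqVneq q (hpt nu t).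
  rewrite (tent_lap_start t0 ttau tauc cl' fPL crossing) eq_sym tcN; last by lra.
  have := Hf (hpt nu t); rewrite !coeff_subU eqxx eq_sym tcN; last by lra.
  by rewrite subr0 -/u ku lerBrDr subr0.
have [->|qtau] := eqVneq q (hpt nu tau).
  rewrite (tent_lap_tau t0 ttau tauc cl' fPL crossing erefl) D0; last by lra.
  by [].
rewrite subr0.
have [[s [stc qE]]|off] := pselect (exists s, t < s <= c /\ q = hpt nu s).
  rewrite qE (tent_lap_inner t0 ttau tauc cl' fPL crossing erefl)//.
    by rewrite D0//; lra.
  by apply: contraNneq qtau => <-; rewrite qE.
rewrite (@tent_lap_off f nu t c tau k v)//.
  apply: le_trans (Hf q) _; rewrite !coeff_subU.
  by rewrite -addrA -opprD gerDl oppr_le0 addr_ge0//; case: eqP.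
by move=> s stc; apply/eqP => qE; apply: off; exists s.
Qed.

Lemma isolated_rank D (r : nat) p : rank D = r%:Z ->
  isolated (weierstrass_locus D) p -> ~ rank_set (D - << r%:Z *g p >>) 1.
Proof.
move=> rD [_ [V Vp VW]] /rank_setP H.
have [nu nut] := tangent_neq0 p.
have tl := hpos_itv nut; have pE := hposK nut.
set t := hpos p nu in tl pE; have [t0 tl'] := andP tl.
have [b [/andP[tb bl] Db _]] := next_point (dom D) tl.
have Vt : nbhs (hpt nu t) V by rewrite pE.
have [|e e0 He] := near_hpt _ Vt; first by lra.
pose c := t + Num.min e (b - t) / 2.
have m0 : 0 < Num.min e (b - t) by rewrite lt_min e0 subr_gt0.
have [me mb] : Num.min e (b - t) <= e /\ Num.min e (b - t) <= b - t.
  by rewrite !ge_min !lexx orbT.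
have tcb : t < c < b by rewrite /c; lra.
have [|tau /andP[ttau tauc] F] := tent_divisor (r := r) t0 tcb bl Db.
  have [f Hf] := H [:: hpt nu c] erefl.
  by exists f; rewrite pE; rewrite big_seq1 in Hf.
have tauW : weierstrass_locus D (hpt nu tau) by apply/(weierstrass_locusP _ rD).
have : (V `&` weierstrass_locus D) (hpt nu tau).
  split=> //; apply: He; first by lra.
  by rewrite distrC ger0_norm; rewrite /c in tauc; lra.
rewrite VW -pE => /hpt_inj E; suff : tau = t by lra.
by apply: E; lra.
Qed.

End IsolatedPoint.

(** * Minimal slopes on segments free of the support and of the locus *)

Section MinimalSlopes.
Context {R : realType} {G : tropicalCurve R}.
Implicit Types (p q x : curve_point G) (nu : edge G * bool) (f : curve_point G -> R).
Variables (D : {freeg (curve_point G)}) (r : nat).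
Hypothesis rankD : rank D = r%:Z.

Lemma rank_linsys : exists f, linsys D f.
Proof.
by apply/rank_set0; apply: (@rank_set_le _ _ D 0 r) => //; case: (rank_natP rankD).
Qed.

Lemma linsys_rank_point p : exists f, linsys (D - << r%:Z *g p >>) f.
Proof.
have [/rank_setP /(_ (nseq r p)) H _] := rank_natP rankD.
have [|f Hf] := H; first by rewrite size_nseq.
exists f; apply: linsys_le Hf => q.
rewrite coeffB coeff_points coeff_subU count_nseq /=.
by case: eqP; rewrite ?mul1n ?mul0n.
Qed.

Lemma weierstrass_coeff p : weierstrass_locus D p <->
  r%:Z < coeff p D - lap (lowest D p) p.
Proof.
have -> : (r%:Z < coeff p D - lap (lowest D p) p) = (r.+1%:Z <= coeff p D - lap (lowest D p) p) by lia.
by rewrite (weierstrass_locusP _ rankD) (linsys_sub_lowest p _ rank_linsys).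
Qed.

Lemma not_weierstrass_coeff p : ~ weierstrass_locus D p ->
  coeff p D - lap (lowest D p) p = r%:Z.
Proof.
move=> /weierstrass_coeff /negP.
have /linsys_sub_lowest := linsys_rank_point p; move=> /(_ isT rank_linsys); lia.
Qed.

Definition min_slope nu (t : R) : int := sl (lowest D (hpt nu t)) nu t.

Lemma min_slope_le f nu (t : R) : linsys D f -> 0 <= t < len nu.1 ->
  min_slope nu t <= sl f nu t.
Proof.
move=> fD tl; have := sl_lowest_le fD (tangent_hpt tl).
by rewrite hpos_hpt.
Qed.

Definition clear_segment nu (a b : R) := [/\ 0 <= a, b <= len nu.1 &
  forall t, a < t < b -> hpt nu t \notin dom D /\ ~ weierstrass_locus D (hpt nu t)].

Lemma clear_segment_flip nu (a b : R) : clear_segment nu a b ->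
  clear_segment (flip nu) (len nu.1 - b) (len nu.1 - a).
Proof.
by move=> [a0 bl H]; split => /=; [lra|lra|move=> t tab; rewrite hpt_flip; apply: H; lra].
Qed.

Lemma lap0_clear nu (a b : R) f (t : R) : clear_segment nu a b -> linsys D f ->
  a < t < b -> lap f (hpt nu t) <= 0.
Proof. by move=> [_ _ H] fD /H[Dt _]; apply: linsys_lap0 Dt. Qed.

(** Outside the locus the reduced divisor has exactly [r] chips at its base point; none comes from
    [D], so all come from the two outgoing slopes. *)
Lemma min_slope_sum nu (a b t : R) : clear_segment nu a b -> a < t < b ->
  min_slope nu t + min_slope (flip nu) (len nu.1 - t) = - r%:Z.
Proof.
move=> [a0 bl H] tab; have [Dt Wt] := H t tab.
have := not_weierstrass_coeff Wt; rewrite coeff_outdom// lap_inner; last by lra.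
by rewrite /min_slope hpt_flip subKr; lia.
Qed.

(** The lowest function based at [t] is concave on the segment, and its slope at [u] bounds the
    minimal slope there. *)
Lemma min_slope_noninc nu (a b t u : R) : clear_segment nu a b -> a <= t -> t < u < b ->
  min_slope nu u <= min_slope nu t.
Proof.
move=> c ta /andP[tu ub]; have [a0 bl _] := c.
have LD := lowest_linsys (hpt nu t) rank_linsys.
apply: le_trans (min_slope_le LD _) _; first by lra.
apply: (@concave_slopes _ _ _ nu t b LD.1) => //; [lra| |lra].
by move=> s sb; apply: lap0_clear c LD _; lra.
Qed.

(* If the minimal slope dropped immediately to the right of [t], the functions
   [lowest D (hpt nu y)] would, as [y] tends to [t], lie below the line of slope
   [min_slope nu t] through [t]. *)
Lemma min_slope_right nu (a b t : R) : clear_segment nu a b -> a <= t < b ->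
  exists2 y, t < y < b & min_slope nu y = min_slope nu t.
Proof.
move=> c /andP[ta tb]; have [a0 bl _] := c.
apply: contrapT => none.
have drop y : t < y < b -> min_slope nu y <= min_slope nu t - 1.
  move=> yb; have le := min_slope_noninc c ta yb.
  have ne : min_slope nu y <> min_slope nu t by move=> E; apply: none; exists y.
  lia.
have LD x := lowest_linsys x rank_linsys.
have tl : 0 <= t < len nu.1 by lra.
have [|d /andP[d0 dtb] gd] := @near0_ex _ _ (b - t) _ (PL_germ (LD (hpt nu t)).1 tl).
  by rewrite subr_gt0.
rewrite -/(min_slope nu t) lowest_base ?add0r in gd; last exact: rank_linsys.
set s := min_slope nu t in drop gd.
(* The estimates below add up to [d <= (r + 1) * e], which this choice excludes. *)
pose e := d / (r%:R + 2%:R).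
have r0 : 0 <= r%:R :> R by [].
have e0 : 0 < e by rewrite divr_gt0//; lra.
have dE : d = (r%:R + 2%:R) * e by rewrite /e mulrC divfK// gt_eqF//; lra.
have re0 : 0 <= r%:R * e by rewrite mulr_ge0// ltW.
have ed : e < d by rewrite dE; lra.
pose h := lowest D (hpt nu (t + e)).
have hD : linsys D h by apply: LD.
have lap0 u : t < u < b -> lap h (hpt nu u) <= 0.
  by move=> ub; apply: lap0_clear c hD _; lra.
have h1 : h (hpt nu (t + e)) <= h (hpt nu t) + (sl h nu t)%:~R * e.
  have := @concave_le _ _ h nu t b hD.1 _ bl lap0 (t + e).
  by rewrite [t + e - t]addrAC subrr add0r; apply; lra.
have h2 : h (hpt nu (t + d)) <= h (hpt nu (t + e)) + (min_slope nu (t + e))%:~R * (d - e).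
  have := @concave_le _ _ h nu (t + e) b hD.1 _ bl _ (t + d).
  have -> : t + d - (t + e) = d - e by ring.
  apply; [lra| |lra].
  by move=> u ub; apply: lap0; lra.
have h3 := lowest_le (hpt nu t) rank_linsys (hpt nu (t + d)) hD.
rewrite gd in h3.
(* Just after [t], the slope of [h] read backwards is at least the minimal slope of [flip nu], and
   the latter is [- r] minus that of [nu]. *)
have kR : (sl h nu t)%:~R <= r%:R + s%:~R :> R.
  have [|w /andP[w0 wb] [_ _ hw]] := @near0_ex _ _ (b - t) _ (sl_right hD.1 tl).
    by rewrite subr_gt0.
  have twb : t < t + w < b by lra.
  have := @min_slope_le h (flip nu) (len nu.1 - (t + w)) hD.
  rewrite hw => /(_ _) h4; have {}h4 : min_slope (flip nu) (len nu.1 - (t + w)) <= - sl h nu t.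
    by apply: h4 => /=; lra.
  have h5 : min_slope nu (t + w) + min_slope (flip nu) (len nu.1 - (t + w)) = - r%:Z.
    by apply: min_slope_sum c _; lra.
  have h6 := drop _ twb.
  have : sl h nu t <= r%:Z + s by move: h4 h5 h6; clear; lia.
  by rewrite -(ler_int R) rmorphD.
have sR : (min_slope nu (t + e))%:~R <= s%:~R - 1 :> R.
  rewrite -(rmorphB _ _ 1) ler_int; apply: drop; lra.
have m1 := ler_wpM2r (ltW e0) kR.
have de0 : 0 <= d - e by lra.
have m2 := ler_wpM2r de0 sR.
have dsE : s%:~R * d = s%:~R * r%:R * e + 2%:R * (s%:~R * e) by rewrite dE; ring.
rewrite dE in m2 h2 h3 *.
move: h1 h2 h3 m1 m2; lra.
Qed.

(** Both orientations have continuity at the start of a segment, by [min_slope_right]. Inside, where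
    the two slopes add up to [- r], continuity of the reversed slope is left continuity of the
    other. So [min_slope nu] is constant on [[a, b)], and the reversed slope at [b] is attained at
    some [y] inside, where the sum is known. *)
Lemma min_slope_clear nu (a b : R) : a < b -> clear_segment nu a b ->
  min_slope nu a + min_slope (flip nu) (len nu.1 - b) = - r%:Z.
Proof.
move=> ab c; have c' := clear_segment_flip c; have [a0 bl _] := c.
have left_cont z : a < z <= b -> exists2 y, a < y < z &
    min_slope (flip nu) (len nu.1 - y) = min_slope (flip nu) (len nu.1 - z).
  move=> zb; have cz : clear_segment nu a z.
    by case: c => _ _ H; split => //; [lra|move=> t ?; apply: H; lra].
  have [|y yz yE] := min_slope_right (clear_segment_flip cz) (t := len nu.1 - z); first by lra.
  by exists (len nu.1 - y); rewrite ?subKr//; lra.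
have cst (x : R) : a <= x < b -> min_slope nu x = min_slope nu a.
  move=> /andP[ax xb].
  apply: (@real_induction _ a x (fun u => min_slope nu u = min_slope nu a)) => //; last by rewrite ax lexx.
    move=> u /andP[au ux] Pu; have [|y yb yE] := min_slope_right c (t := u); first by lra.
    apply/near0P; exists (y - u) => [|s sy]; first by lra.
    rewrite -(Pu u) ?au ?lexx//; apply/eqP; rewrite eq_le; apply/andP; split.
      by apply: min_slope_noninc c _ _; lra.
    by rewrite -yE; apply: min_slope_noninc c _ _; lra.
  move=> u uax Pu; have [|y yu yE] := left_cont u; first by lra.
  rewrite -(Pu y); last by lra.
  have := min_slope_sum c (t := u); have := min_slope_sum c (t := y); rewrite yE => h1 h2.
  by apply: (addIr (min_slope (flip nu) (len nu.1 - u))); rewrite h1 ?h2//; lra.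
have [|y yb yE] := left_cont b; first by lra.
rewrite -yE -(cst y); last by lra.
by apply: min_slope_sum c _.
Qed.

End MinimalSlopes.

(** * The genus as a count of edges and vertices *)

Section Genus.
Context {R : realType} {G : tropicalCurve R}.

Lemma edge_invariant (T : Type) (w : vertex G -> T) :
  (forall e : edge G, w (src e) = w (tgt e)) -> forall u v, w u = w v.
Proof.
move=> we u v; have /connectP[s] := vertex_connected u v.
elim: s u => [|x s ih] u /=; first by move=> _ ->.
move=> /andP[/existsP[e /orP[]/andP[/eqP eu /eqP ex]] xs vE];
  by rewrite -(ih x xs vE) -eu -ex we.
Qed.

(** The kernel of the transpose consists of the functions on vertices with equal values at the ends
    of every edge. By connectedness these are the constants, so the boundary map has rank one less
    than the number of vertices. *)
Lemma genusE : (genus G)%:Z = #|edge G|%:Z - #|vertex G|%:Z + 1.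
Proof.
have [e0 _] := card_gt0P (edge_nonempty G).
set B := boundary_mx G.
have mulB (u : 'rV[R]_#|vertex G|) i : (u *m B^T) 0 i =
    u 0 (enum_rank (tgt (enum_val i))) - u 0 (enum_rank (src (enum_val i))).
  rewrite mxE.
  under eq_bigr do rewrite !mxE mulrBr.
  rewrite sumrB; congr (_ - _).
    rewrite (bigD1 (enum_rank (tgt (enum_val i))))//= enum_rankK eqxx mulr1.
    rewrite big1 ?addr0// => j /eqP ne; case: eqP => E; rewrite ?mulr0//.
    by case: ne; rewrite E enum_valK.
  rewrite (bigD1 (enum_rank (src (enum_val i))))//= enum_rankK eqxx mulr1.
  rewrite big1 ?addr0// => j /eqP ne; case: eqP => E; rewrite ?mulr0//.
  by case: ne; rewrite E enum_valK.
pose one : 'rV[R]_#|vertex G| := const_mx 1.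
have oneK : (one <= kermx B^T)%MS.
  by apply/sub_kermxP/rowP => i; rewrite mulB !mxE subrr.
have Kone : (kermx B^T <= one)%MS.
  apply/row_subP => i; set u := row i _.
  have /sub_kermxP uB : (u <= kermx B^T)%MS by apply: row_sub.
  have -> : u = u 0 (enum_rank (src e0)) *: one; last exact: scalemx_sub.
  pose w v := u 0 (enum_rank v).
  have we e : w (src e) = w (tgt e).
    have := mulB u (enum_rank e); rewrite uB enum_rankK mxE => /esym/eqP.
    by rewrite subr_eq0 => /eqP E; rewrite /w E.
  apply/rowP => j; rewrite [RHS]mxE [one 0 j]mxE mulr1 -[j]enum_valK.
  exact: (edge_invariant we).
have rk1 : \rank (kermx B^T) = 1%N.
  have /eqmxP E : (kermx B^T == one)%MS by rewrite Kone oneK.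
  rewrite E rank_rV; suff -> : one != 0 by [].
  apply/eqP => /rowP/(_ (enum_rank (src e0))); rewrite !mxE => /eqP.
  by rewrite oner_eq0.
have := mxrank_ker B^T; rewrite rk1 mxrank_tr => rkB.
have := mxrank_ker B; rewrite /genus -/B => ->.
have := rank_leq_row B; lia.
Qed.

End Genus.

(** * Summing the minimal slopes over a subdivision of the curve *)

Section TotalWeight.
Context {R : realType} {G : tropicalCurve R}.
Implicit Types (p q : curve_point G) (nu : edge G * bool).

(** A regrouping: each gap between consecutive points contributes [A] at its left end and [B] at its
    right end, and there is one more gap than inner points. *)
Lemma chain_sum (A B : R -> int) (k : int) (u w : R) (cs : seq R) :
    path <%R u (rcons cs w) ->
    (forall x y : R, u <= x -> x < y -> y <= w -> (forall t, x < t < y -> t \notin cs) ->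
      A x + B y = k) ->
  A u + B w + \sum_(c <- cs) (A c + B c) = k * (size cs).+1%:Z.
Proof.
elim: cs u => [|c cs ih] u /=.
  by move=> /andP[uw _] H; rewrite big_nil addr0 mulr1 H.
move=> /andP[uc cw] H.
have csw : c < w /\ forall t, t \in cs -> c < t.
  have /allP a := lt_path_min cw; split; first by apply: a; rewrite mem_rcons mem_head.
  by move=> t tcs; apply: a; rewrite mem_rcons in_cons tcs orbT.
have [cw' cs'] := csw.
have := ih c cw _; rewrite big_cons => IH.
have Auc : A u + B c = k.
  apply: H => //; first exact: ltW.
  move=> t /andP[ut tc]; rewrite in_cons negb_or (lt_eqF tc)/=.
  by apply/negP => /cs' ct; move: (lt_trans ct tc); rewrite ltxx.
have -> : (size cs).+2%:Z = (size cs).+1%:Z + 1 by lia.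
rewrite mulrDr mulr1 -IH ?Auc; last first.
  move=> x y cx xy yw Hxy; apply: H => //; first by rewrite ltW// (lt_le_trans uc).
  move=> t txy; rewrite in_cons negb_or Hxy// andbT gt_eqF//.
  by case/andP: txy => xt _; apply: le_lt_trans xt.
rewrite -Auc; ring.
Qed.

Lemma deg_coeff (D : {freeg (curve_point G)}) (S : seq (curve_point G)) :
  uniq S -> {subset dom D <= S} -> \sum_(p <- S) coeff p D = deg D.
Proof.
move=> uS DS; rewrite -{2}(freeg_sumE D) raddf_sum/=.
under [RHS]eq_bigr do rewrite degU.
rewrite (bigID (mem (dom D)))/= [X in _ + X]big1 ?addr0 => [|p]; last exact: coeff_outdom.
rewrite -big_filter; apply: perm_big; apply: uniq_perm.
- exact: filter_uniq.
- exact: uniq_dom.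
- by move=> p; rewrite mem_filter andb_idr// => /DS.
Qed.

Section Sum.
Variables (D : {freeg (curve_point G)}) (r : nat).
Hypothesis rankD : rank D = r%:Z.

Local Notation interior_point := {x : edge G * R | 0 < x.2 < len x.1}.
Variable T : seq interior_point.
Hypothesis uT : uniq T.
Hypothesis domT : forall x : interior_point, inr x \in dom D -> x \in T.
Hypothesis WT : forall x : interior_point, weierstrass_locus D (inr x) -> x \in T.

Lemma edge_sum (e : edge G) :
  min_slope D (e, true) 0 + min_slope D (e, false) 0
    + \sum_(x <- T | (val x).1 == e) lap (lowest D (inr x)) (inr x)
  = - r%:Z * (size [seq x <- T | (val x).1 == e]).+1%:Z.
Proof.
pose Te := [seq x <- T | (val x).1 == e].
pose cs := sort <=%O [seq (val x).2 | x <- Te].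
pose A t := min_slope D (e, true) t; pose B t := min_slope D (e, false) (len e - t).
have TeE (x : interior_point) : x \in Te -> exists tP, x = exist _ (e, (val x).2) tP.
  rewrite mem_filter => /andP[/eqP xe _]; case: x xe => [[e' t] /= tP] E; subst e'.
  by exists tP.
have csE (t : R) : t \in cs -> 0 < t < len e.
  by rewrite mem_sort => /mapP[x /TeE[tP _] ->].
have ucs : sorted <%O cs.
  rewrite sort_lt_sorted map_inj_in_uniq ?filter_uniq// => x y /TeE[xP ->] /TeE[yP ->] /= E.
  by apply: val_inj; rewrite /= E.
have pcs : path <%R 0 (rcons cs (len e)).
  rewrite rcons_path lt_path_sortedE ucs andbT; apply/andP; split.
    by apply/allP => t /csE/andP[].
  have : last 0 cs \in 0 :: cs by apply: mem_last.
  by rewrite in_cons => /predU1P[->|/csE/andP[]//]; apply: len_gt0.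
have chain (x y : R) : 0 <= x -> x < y -> y <= len e -> (forall t, x < t < y -> t \notin cs) ->
    A x + B y = - r%:Z.
  move=> x0 xy yl H; apply: (@min_slope_clear _ _ D r rankD (e, true) x y xy).
  split => // t txy; have tP : 0 < t < len e by lra.
  have nT : exist _ (e, t) tP \notin T.
    apply: contra (H t txy) => tT; rewrite mem_sort; apply/mapP.
    by exists (exist _ (e, t) tP) => //; rewrite mem_filter eqxx.
  rewrite /hpt /= pt_inner; split; first by apply: contra nT => /domT.
  by move=> /WT tT; rewrite tT in nT.
have := @chain_sum A B (- r%:Z) 0 (len e) cs pcs chain.
rewrite /A /B subrr size_sort size_map -/Te => <-; congr (_ + _).
rewrite (perm_big [seq (val x).2 | x <- Te])/=; last by rewrite perm_sort.
rewrite big_map /Te big_filter; apply: eq_bigr => -[[e' t] /= tP] /eqP E; subst e'.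
rewrite -pt_inner -[pt e t]/(hpt (e, true) t) lap_inner//.
by rewrite /min_slope /hpt /= subKr.
Qed.

(** Every half-edge starts at exactly one vertex, so the vertex terms give each edge, loop or not,
    the slopes at its two ends. The points of [T] then cut the edges into [#|edge G| + size T] clear
    segments, worth [- r] each. *)
Lemma lowest_lap_sum :
  \sum_(v : vertex G) lap (lowest D (inl v)) (inl v)
    + \sum_(x <- T) lap (lowest D (inr x)) (inr x)
  = - r%:Z * (#|edge G|%:Z + (size T)%:Z).
Proof.
have -> : \sum_(v : vertex G) lap (lowest D (inl v)) (inl v) =
    \sum_(e : edge G) (min_slope D (e, true) 0 + min_slope D (e, false) 0).
  transitivity (\sum_(nu : edge G * bool) min_slope D nu 0).
    rewrite (partition_big (fun nu : edge G * bool => if nu.2 then src nu.1 else tgt nu.1) predT)//=.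
    apply: eq_bigr => v _; rewrite /lap; apply: eq_big => [nu|nu].
      by rewrite inE.
    by move=> /hposK /= <-; rewrite /min_slope hpt0 /=.
  rewrite -(pair_bigA _ (fun e b => min_slope D (e, b) 0))/=.
  by apply: eq_bigr => e _; rewrite big_bool.
rewrite (partition_big (fun x : interior_point => (val x).1) predT)//= -big_split/=.
under eq_bigr do rewrite edge_sum.
rewrite -mulr_sumr; congr (_ * _).
under eq_bigr do rewrite -addn1 PoszD addrC.
rewrite big_split /= sumr_const natz; congr (_ + _).
rewrite -(big_morph Posz PoszD erefl) -sum1_size.
under eq_bigr do rewrite -sum1_size big_filter.
by rewrite [in RHS](partition_big (fun x : interior_point => (val x).1) predT).
Qed.

End Sum.

End TotalWeight.

(** * Gap sequences at isolated points, and the total weight *)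

Section WeierstrassPoints.
Context {R : realType} {G : tropicalCurve R}.
Variables (D : {freeg (curve_point G)}) (r : nat).
Hypothesis rankD : rank D = r%:Z.

Lemma isolated_gap_sequence p : isolated (weierstrass_locus D) p ->
  gap_sequence D p =
    rcons [seq i%:Z | i <- iota 1 r] (coeff p (reduced_divisor p D) + 1).
Proof.
move=> isop; have D0 := rank_linsys rankD.
rewrite coeff_reduced_divisor//; apply: gap_sequenceE => //.
- by apply/(weierstrass_coeff rankD); exact: isolatedS isop.
- by move=> j; apply: linsys_sub_lowest.
- exact: isolated_rank isop.
Qed.

Lemma finite_isolated (T : topologicalType) (A : set T) (x : T) :
  hausdorff_space T -> finite_set A -> A x -> isolated A x.
Proof.
move=> hT fA Ax; split; first exact: mem_set.
exists (~` (A `\ x)).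
  apply: open_nbhs_nbhs; split; last by move=> [_]; apply.
  apply: closed_openC; move/hausdorff_accessible/accessible_finite_set_closed: hT.
  by apply; apply: finite_setD.
apply/seteqP; split=> [y [nAy Ay]|_ ->]; first by apply: contrapT => yx; apply: nAy.
by split=> // -[_]; apply.
Qed.

(** The weight [phi p - r] vanishes off the locus, so it can be summed over the vertices together
    with [T], the interior points of the locus or of the support. The result is [deg D + r (#|edge
    G| + size T) - r (#|vertex G| + size T)]. *)
Lemma total_weight : finite_set (weierstrass_locus D) ->
  \sum_(p \in weierstrass_locus D) weight D p = r%:Z * (genus G)%:Z - r%:Z + deg D.
Proof.
move=> fW; set W := weierstrass_locus D in fW *.
pose phi p := coeff p D - lap (lowest D p) p.
have wE p : p \in W -> weight D p = phi p - r%:Z.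
  move=> /set_mem Wp; rewrite (weightE (r := r) (m := phi p))//.
  rewrite isolated_gap_sequence; last by apply: finite_isolated => //; apply: metric_hausdorff.
  by rewrite coeff_reduced_divisor//; apply: rank_linsys rankD.
rewrite (eq_fsbigr _ _ wE).
have [w WE] := (finite_seqP W).1 fW.
pose T := undup (pmap (fun q : curve_point G => if q is inr x then Some x else None)
  (dom D ++ w)).
have TP x : inr x \in dom D ++ w -> x \in T.
  move=> xS; rewrite mem_undup mem_pmap; apply/mapP.
  by exists (inr x).
have uT : uniq T by apply: undup_uniq.
have domT x : inr x \in dom D -> x \in T by move=> xD; apply: TP; rewrite mem_cat xD.
have WT x : W (inr x) -> x \in T.
  by rewrite WE => xw; apply: TP; rewrite mem_cat [_ \in w]xw orbT.
pose S : seq (curve_point G) := [seq inl v | v <- enum (vertex G)] ++ [seq inr x | x <- T].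
have uS : uniq S.
  rewrite cat_uniq; apply/and3P; split.
  - by rewrite map_inj_uniq ?enum_uniq// => x y [].
  - by apply/hasPn => _ /mapP[x _ ->]; apply/mapP => -[].
  - by rewrite map_inj_uniq// => x y [].
have SP (q : curve_point G) : (forall x, q = inr x -> x \in T) -> q \in S.
  rewrite mem_cat; case: q => [v _|x /(_ x erefl) xT]; first by rewrite map_f ?mem_enum.
  by rewrite (map_f inr xT) orbT.
rewrite (fsbig_fwiden S)//=; last 2 first.
- by move=> q Wq; apply: SP => x qE; apply: WT; rewrite -qE.
- move=> q [_ nWq]; apply/eqP; rewrite subr_eq0; apply/eqP.
  exact: not_weierstrass_coeff rankD _ nWq.
rewrite sumrB sumrB deg_coeff//; last first.
  by move=> q qD; apply: SP => x qE; apply: domT; rewrite -qE.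
have -> : \sum_(q <- S) lap (lowest D q) q = - r%:Z * (#|edge G|%:Z + (size T)%:Z).
  by rewrite -(lowest_lap_sum rankD uT domT WT) /S big_cat/= big_map big_enum big_map.
rewrite big_const_seq count_predT iter_addr_0 /S size_cat size_map (size_map inr T) -cardE genusE.
rewrite -mulr_natr natz PoszD; ring.
Qed.

End WeierstrassPoints.

Theorem theorem1p1 (R : realType) (G : tropicalCurve R)
    (hg : (2 <= genus G)%N) (D : {freeg (curve_point G)}) (d : int) (r : nat)
    (hd : deg D = d) (hr : rank D = r%:Z) :
  (forall p : curve_point G, isolated (weierstrass_locus D) p ->
     gap_sequence D p =
       rcons [seq i%:Z | i <- iota 1 r] (coeff p (reduced_divisor p D) + 1)
     /\ weight D p = coeff p (reduced_divisor p D) - r%:Z)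
  /\
  (finite_set (weierstrass_locus D) ->
     \sum_(p \in weierstrass_locus D) weight D p
       = r%:Z * (genus G)%:Z - r%:Z + d).
Proof.
split=> [p isop|fW]; last by rewrite (total_weight hr fW) hd.
have gaps := isolated_gap_sequence hr isop.
by split=> //; apply: (weightE gaps).
Qed.
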